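(* Let $T$ be a theory of continuous first order logic and $\varphi(x,y)$ a formula which is stable in $T$. Let $M\models T$. Assume that $A\subseteq M$ is algebraically closed, that $p,p'\in \mathrm S_\varphi(M)$ are both definable over $A$, and that $p{\restriction}_A=p'{\restriction}_A$. Then $p=p'$.
   Context: **Continuous logic.** Truth values lie in $[0,1]$, $0$ meaning true. A (metric, possibly many-sorted) continuous signature $\mathcal L$ consists of function and predicate symbols of finite arities, a distinguished binary predicate symbol $d$ on each sort, and for each symbol and each argument a uniform continuity modulus. An $\mathcal L$-structure interprets function symbols by functions and predicate symbols by $[0,1]$-valued functions, with $d$ a complete metric and each symbol respecting its moduli in each argument. Formulae are built from atomic ones using the connectives $\neg x=1-x$, $x/2$, $x\dot- y=\max(x-y,0)$ and the quantifiers $\sup,\inf$. A condition is $\varphi=0$; a theory (not necessarily complete) is a set of conditions without free variables. Finite tuples of variables are treated as single variables. **Stability.** $\varphi(x,y)$ is $\varepsilon$-stable ($\varepsilon>0$) if in no model of $T$ is there an infinite sequence $(a_i,b_i)_{i<\omega}$ with $|\varphi(a_i,b_j)-\varphi(a_j,b_i)|\ge\varepsilon$ for all $i<j$; it is stable if $\varepsilon$-stable for all $\varepsilon>0$. **Types over models.** $\mathrm S_x(M)$ is the space of complete types over $M$ in the variable $x$, with the coarsest topology making $p\mapsto\psi^p$ continuous for every formula $\psi(x)$ with parameters in $M$ ($\psi^p$ being the value of $\psi$ at a realisation of $p$). $\mathrm S_\varphi(M)$ is the quotient space of $\mathrm S_x(M)$ identifying two types when they give the same value to $\varphi(x,b)$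 for every $b\in M$. A $\varphi$-predicate over $M$ is a continuous function $\mathrm S_\varphi(M)\to[0,1]$. An $M$-definable predicate $\psi(y)$ is a continuous function $\mathrm S_y(M)\to[0,1]$ (equivalently a uniform limit of formulae with parameters in $M$), evaluated at $b$ in an elementary extension of $M$ through $\mathrm{tp}(b/M)$. The definition $d_p\varphi(y)$ of $p\in\mathrm S_\varphi(M)$ is the unique $M$-definable predicate $\psi(y)$ with $\varphi(x,b)^p=\psi(b)$ for all $b\in M$ (it exists since $\varphi$ is stable). **Types over sets.** All models are elementary substructures of a monster model $\mathfrak M$ ($\kappa$-saturated and strongly $\kappa$-homogeneous for a very large $\kappa$) of the relevant complete theory, and all parameter sets are small subsets of it. A $\varphi$-predicate over $A$ is a $\varphi$-predicate over $\mathfrak M$ which is $\mathrm{Aut}(\mathfrak M/A)$-invariant; $\mathrm S_\varphi(A)$ is the quotient space of $\mathrm S_\varphi(\mathfrak M)$ identifying types at which all $\varphi$-predicates over $A$ take equal values. (This agrees with the previous definition when $A$ is a model.) $p{\restriction}_A$ is the image of $p$ under the restriction map $\mathrm S_\varphi(M)\to\mathrm S_\varphi(A)$. $p\in \mathrm S_\varphi(M)$ is definable over $A\subseteq M$ if $d_p\varphi$ is an $A$-definable predicate (equivalently, $\mathrm{Aut}(\mathfrak M/A)$-invariant). $\mathrm{acl}(A)$ is the set of all elements $b$ (of any sort) such that the set of realisations of $\mathrm{tp}(b/A)$ in $\mathfrak M$ is metrically compact; $A$ is algebraically closed if $A=\mathrm{acl}(A)$. **Standing convention.** $\mathcal L$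 is assumed to have, for every stable formula $\varphi(x,y)$, a sort $S_{d\varphi}$ of canonical parameters for instances of the predicate $d\varphi(y,X)$ defined as follows (so $\mathrm{acl}$ is computed with these sorts included). For a sequence $(a_n)$ in $[0,1]$ put $a_{*,0}=a_0$, let $a_{*,n+1}$ be the point of $[a_{*,n}-2^{-n-1},a_{*,n}+2^{-n-1}]$ closest to $a_{n+1}$, and $\mathrm{flim}_n a_n=\lim_n a_{*,n}$. $N(\varphi,\varepsilon)$ is the least $N$ such that in no model of $T$ is there a sequence $(a_i,b_i)_{i<N+1}$ with $|\varphi(a_j,b_i)-\varphi(a_j,b_k)|\ge\varepsilon$ for all $i<j<k$. $d^\varepsilon\varphi(y,x_{<2N(\varphi,\varepsilon)-1})$ is the median of the $2N(\varphi,\varepsilon)-1$ values $\varphi(x_i,y)$; $X=(x^n_i:n<\omega,i<2N(\varphi,2^{-n})-1)$ and $d\varphi(y,X)=\mathrm{flim}_n d^{2^{-n}}\varphi(y,x^n_{<2N(\varphi,2^{-n})-1})$. In a structure $M$, $S_{d\varphi}$ is the completion of the quotient of the set of families $C$ of elements of $M$ indexed like $X$ by the pseudo-metric $\sup_y|d\varphi(y,C)-d\varphi(y,C')|$, with the induced metric and with the predicate $P(y,[C])=d\varphi(y,C)$. *)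

(* Defs.v *)
From HB Require Import structures.
From mathcomp Require Import all_boot all_order all_algebra.
From mathcomp Require Import all_classical all_reals all_analysis.

Set Implicit Arguments.
Unset Strict Implicit.
Unset Printing Implicit Defensive.

Import Order.TTheory GRing.Theory Num.Theory.
Import numFieldNormedType.Exports.

Local Open Scope classical_set_scope.
Local Open Scope quotient_scope.
Local Open Scope card_scope.
Local Open Scope ring_scope.

Record modulus (R : realType) := Modulus {
  modfun :> R -> R;
  modfun_gt0 : forall e, 0 < e -> 0 < modfun e }.

(** Symbols are indexed by their arity: a number of arguments [n], the sorts
    of the arguments, and (for function symbols) the sort of the result. *)
Record signature (R : realType) := Signature {
  lsort : Type;
  fsym : forall n : nat, ('I_n -> lsort) -> lsort -> Type;
  psym : forall n : nat, ('I_n -> lsort) -> Type;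
  dsym : forall s : lsort, psym (fun _ : 'I_2 => s);
  fmod : forall n (ar : 'I_n -> lsort) s, fsym ar s -> 'I_n -> modulus R;
  pmod : forall n (ar : 'I_n -> lsort), psym ar -> 'I_n -> modulus R }.

Record structure (R : realType) (L : signature R) := Structure {
  carrier :> lsort L -> metricType R;
  fint : forall n (ar : 'I_n -> lsort L) s,
    fsym ar s -> (forall i, carrier (ar i)) -> carrier s;
  pint : forall n (ar : 'I_n -> lsort L),
    psym ar -> (forall i, carrier (ar i)) -> R;
  carrier_inhabited : forall s, inhabited (carrier s);
  carrier_complete : forall s (u : nat -> carrier s),
    cauchy (u @ \oo) -> exists l : carrier s, u @ \oo --> l;
  pint_itv : forall n (ar : 'I_n -> lsort L) (P : psym ar) v,
    0 <= pint P v <= 1;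
  pint_dsym : forall s (v : 'I_2 -> carrier s),
    pint (dsym s) v = mdist (v ord0) (v ord_max);
  fint_mod : forall n (ar : 'I_n -> lsort L) s (f : fsym ar s) (i : 'I_n)
    (u v : forall i, carrier (ar i)) (e : R),
    (forall j, j != i -> u j = v j) -> 0 < e ->
    mdist (u i) (v i) < fmod f i e -> mdist (fint f u) (fint f v) <= e;
  pint_mod : forall n (ar : 'I_n -> lsort L) (P : psym ar) (i : 'I_n)
    (u v : forall i, carrier (ar i)) (e : R),
    (forall j, j != i -> u j = v j) -> 0 < e ->
    mdist (u i) (v i) < pmod P i e -> `|pint P u - pint P v| <= e }.

Section Contexts.
Context {S : Type}.

(** A context is a type of variables together with the sort of each of them.
    [oext sg s] adds one variable of sort [s]; [csum sg ta] is the context of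
    a formula in two groups of variables. *)
Definition oext (V : Type) (sg : V -> S) (s : S) (o : option V) : S :=
  if o is Some v then sg v else s.

Definition csum (V W : Type) (sg : V -> S) (ta : W -> S) (i : V + W) : S :=
  match i with inl v => sg v | inr w => ta w end.

End Contexts.

Section Arguments.
Context {R : realType} {L : signature R}.

Definition args (M : structure L) (V : Type) (sg : V -> lsort L) : Type :=
  forall v, M (sg v).

Definition aext (M : structure L) (V : Type) (sg : V -> lsort L) (s : lsort L)
    (v : args M sg) (a : M s) : args M (oext sg s) :=
  fun o => match o return M (oext sg s o) with Some i => v i | None => a end.

Definition apair (M : structure L) (V W : Type) (sg : V -> lsort L)
    (ta : W -> lsort L) (a : args M sg) (b : args M ta) :
    args M (csum sg ta) :=
  fun i => match i return M (csum sg ta i) with inl v => a v | inr w => b w end.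

Definition amap (M N : structure L) (f : forall s, M s -> N s)
    (V : Type) (sg : V -> lsort L) (a : args M sg) : args N sg :=
  fun v => f _ (a v).

Definition aone (M : structure L) (s : lsort L) (a : M s) :
  args M (fun _ : 'I_1 => s) := fun=> a.

Definition anil (M : structure L) : args M (of_void (lsort L)) :=
  fun i => match i with end.

End Arguments.

Inductive term (R : realType) (L : signature R) (V : Type)
    (sg : V -> lsort L) : lsort L -> Type :=
  | Var (v : V) : term sg (sg v)
  | App n (ar : 'I_n -> lsort L) s (f : fsym ar s)
      (ts : forall i, term sg (ar i)) : term sg s.

(** The context is a non-uniform parameter: a quantifier binds the variable
    [None] of the extended context. *)
Inductive formula (R : realType) (L : signature R) (V : Type)
    (sg : V -> lsort L) : Type :=
  | Pred n (ar : 'I_n -> lsort L) (P : psym ar) (ts : forall i, term sg (ar i))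
  | Neg (phi : formula sg)
  | Half (phi : formula sg)
  | Dotminus (phi psi : formula sg)
  | Sup (s : lsort L) (phi : formula (oext sg s))
  | Inf (s : lsort L) (phi : formula (oext sg s)).

Section Semantics.
Context {R : realType} {L : signature R} (M : structure L).

Fixpoint teval (V : Type) (sg : V -> lsort L) (v : args M sg) s
    (t : term sg s) : M s :=
  match t with
  | Var i => v i
  | App n ar s f ts => fint f (fun i => teval v (ts i))
  end.

Fixpoint eval (V : Type) (sg : V -> lsort L) (phi : formula sg) :
    args M sg -> R :=
  match phi with
  | Pred n ar P ts => fun v => pint P (fun i => teval v (ts i))
  | Neg phi => fun v => 1 - eval phi v
  | Half phi => fun v => eval phi v / 2
  | Dotminus phi psi => fun v => Num.max (eval phi v - eval psi v) 0
  | Sup s phi => fun v => sup [set eval phi (aext v a) | a in [set: M s]]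
  | Inf s phi => fun v => inf [set eval phi (aext v a) | a in [set: M s]]
  end.

End Semantics.

Definition theory (R : realType) (L : signature R) :=
  set (formula (of_void (lsort L))).

Definition models (R : realType) (L : signature R) (M : structure L)
    (T : theory L) : Prop :=
  forall phi, T phi -> eval phi (anil M) = 0.

Record elem_emb (R : realType) (L : signature R) (M N : structure L) :=
  ElemEmb {
    emb :> forall s, M s -> N s;
    embP : forall (V : Type) (sg : V -> lsort L) (phi : formula sg)
      (v : args M sg), eval phi (amap emb v) = eval phi v }.

Record automorphism (R : realType) (L : signature R) (M : structure L) :=
  Automorphism {
    aut :> forall s, M s -> M s;
    aut_bij : forall s, bijective (@aut s);
    aut_fint : forall n (ar : 'I_n -> lsort L) s (f : fsym ar s)
      (v : args M ar), aut (fint f v) = fint f (amap aut v);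
    aut_pint : forall n (ar : 'I_n -> lsort L) (P : psym ar)
      (v : args M ar), pint P (amap aut v) = pint P v }.

Section Embeddings.
Context {R : realType} {L : signature R}.

Lemma emb_idP (M : structure L) (V : Type) (sg : V -> lsort L)
    (phi : formula sg) (v : args M sg) :
  eval phi (amap (fun s => @id (M s)) v) = eval phi v.
Proof. by []. Qed.

Definition emb_id (M : structure L) : elem_emb M M :=
  ElemEmb (@emb_idP M).

Lemma emb_compP (M N P : structure L) (g : elem_emb N P) (f : elem_emb M N)
    (V : Type) (sg : V -> lsort L) (phi : formula sg) (v : args M sg) :
  eval phi (amap (fun s => g s \o f s) v) = eval phi v.
Proof. by rewrite -(embP f) -(embP g). Qed.

Definition emb_comp (M N P : structure L) (g : elem_emb N P)
  (f : elem_emb M N) : elem_emb M P := ElemEmb (emb_compP g f).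

Lemma teval_aut (M : structure L) (g : automorphism M) (V : Type)
    (sg : V -> lsort L) (v : args M sg) s (t : term sg s) :
  teval (amap g v) t = g s (teval v t).
Proof.
elim: t => //= n ar s' f ts IH; rewrite aut_fint; congr fint.
by apply: functional_extensionality_dep => i; exact: IH.
Qed.

Lemma amap_aext (M N : structure L) (g : forall s, M s -> N s) (V : Type)
    (sg : V -> lsort L) (s : lsort L) (v : args M sg) (a : M s) :
  amap g (aext v a) = aext (amap g v) (g s a).
Proof. by apply: functional_extensionality_dep => -[]. Qed.

Lemma aut_image (M : structure L) (g : automorphism M) (s : lsort L)
    (F : M s -> R) : [set F (g s a) | a in [set: M s]] = F @` [set: M s].
Proof.
apply/seteqP; split => _ [a _ <-]; first by exists (g s a).
by have [h _ hK] := aut_bij g s; exists (h a) => //; rewrite hK.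
Qed.

Lemma aut_embP (M : structure L) (g : automorphism M) (V : Type)
    (sg : V -> lsort L) (phi : formula sg) (v : args M sg) :
  eval phi (amap g v) = eval phi v.
Proof.
elim: phi v => {V sg} [V sg n ar P ts|V sg phi IH|V sg phi IH
  |V sg phi IH psi IH'|V sg s phi IH|V sg s phi IH] v /=.
- rewrite -[RHS](aut_pint g); congr pint.
  by apply: functional_extensionality_dep => i; exact: teval_aut.
- by rewrite IH.
- by rewrite IH.
- by rewrite IH IH'.
- rewrite -(aut_image g); congr sup; apply: eq_imagel => a _.
  by rewrite -amap_aext IH.
- rewrite -(aut_image g); congr inf; apply: eq_imagel => a _.
  by rewrite -amap_aext IH.
Qed.

Definition emb_aut (M : structure L) (g : automorphism M) : elem_emb M M :=
  ElemEmb (aut_embP g).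

End Embeddings.

Section Stability.
Context {R : realType} {L : signature R} (T : theory L).
Context {n m : nat} {sg : 'I_n -> lsort L} {ta : 'I_m -> lsort L}.
Variable phi : formula (csum sg ta).

Definition eps_stable (e : R) : Prop :=
  ~ exists (N : structure L) (a : nat -> args N sg) (b : nat -> args N ta),
      models N T /\ forall i j, (i < j)%N ->
        e <= `|eval phi (apair (a i) (b j)) - eval phi (apair (a j) (b i))|.

Definition stable : Prop := forall e, 0 < e -> eps_stable e.

Definition has_chain (e : R) (k : nat) : Prop :=
  exists (N : structure L) (a : 'I_k -> args N sg) (b : 'I_k -> args N ta),
    models N T /\ forall i j l : 'I_k, (i < j)%N -> (j < l)%N ->
      e <= `|eval phi (apair (a j) (b i)) - eval phi (apair (a j) (b l))|.

(** The value 0 is a dummy for the case where there is no such [k]. *)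
Definition Nphi (e : R) : nat :=
  xget 0%N [set k | ~ has_chain e k.+1 /\
                    forall k', ~ has_chain e k'.+1 -> (k <= k')%N].

(** The middle element of the sorted list; only used at odd lengths. *)
Definition median (s : seq R) : R := nth 0 (path.sort <=%R s) (size s)./2.

(** The forced limit; the point of [[c - d, c + d]] closest to [x] is
    [max (c - d) (min x (c + d))]. *)
Fixpoint fseq (a : nat -> R) (k : nat) : R :=
  if k is k'.+1 then
    Num.max (fseq a k' - 2 ^- k) (Num.min (a k) (fseq a k' + 2 ^- k))
  else a 0%N.

Definition flim (a : nat -> R) : R := limn (fseq a).

Definition cfamily (M : structure L) : Type :=
  forall k : nat, 'I_(2 * Nphi (2 ^- k)).-1 -> args M sg.

Definition dphi_eps (M : structure L) (e : R) (y : args M ta)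
    (c : 'I_(2 * Nphi e).-1 -> args M sg) : R :=
  median [seq eval phi (apair (c i) y) | i <- enum 'I_(2 * Nphi e).-1].

Definition dphi (M : structure L) (y : args M ta) (C : cfamily M) : R :=
  flim (fun k => dphi_eps y (C k)).

(** The sort [s] and the predicate symbol [P] (with arguments [y], then one
    argument of sort [s]) are those of the canonical parameters for
    [dphi y X]: in every model, the map [cls] exhibits the sort [s], which is a
    complete metric space, as the completion of the quotient of the set of
    families by the pseudo-metric. *)
Definition canonical_sort (s : lsort L)
    (P : psym (fun i : 'I_m.+1 => oext ta s (unlift ord_max i))) : Prop :=
  forall M : structure L, models M T ->
  exists cls : cfamily M -> M s,
    [/\ forall C C' : cfamily M, mdist (cls C) (cls C') =
          sup [set `|dphi y C - dphi y C'| | y in [set: args M ta]],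
        dense (range cls) &
        forall (y : args M ta) (C : cfamily M),
          pint P (fun i => aext y (cls C) (unlift ord_max i)) = dphi y C].

End Stability.

Definition has_canonical_sorts (R : realType) (L : signature R)
    (T : theory L) : Prop :=
  forall n m (sg : 'I_n -> lsort L) (ta : 'I_m -> lsort L)
    (phi : formula (csum sg ta)), stable T phi ->
  exists s (P : psym (fun i : 'I_m.+1 => oext ta s (unlift ord_max i))),
    canonical_sort T phi P.

Definition sset (R : realType) (L : signature R) (M : structure L) :=
  forall s, set (M s).

Definition sfull (R : realType) (L : signature R) (M : structure L) : sset M :=
  fun s => setT.

Arguments sfull {R L} M s.

Definition simage (R : realType) (L : signature R) (M N : structure L)
  (f : forall s, M s -> N s) (A : sset M) : sset N := fun s => f s @` A s.

Arguments simage {R L M N} f A s.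

Definition smaps (R : realType) (L : signature R) (M N : structure L)
    (f : forall s, M s -> N s) (A : sset M) (B : sset N) : Prop :=
  forall s (a : M s), A s a -> B s (f s a).

(** A formula in the variables [sg] with parameters in [A]: a formula with a
    further finite tuple of variables, and elements of [A] for the latter. *)
Record pformula (R : realType) (L : signature R) (M : structure L)
    (A : sset M) (n : nat) (sg : 'I_n -> lsort L) := PFormula {
  pnum : nat;
  psort : 'I_pnum -> lsort L;
  pbody : formula (csum sg psort);
  params : args M psort;
  params_in : forall i, A (psort i) (params i) }.

Arguments psort {R L M A n sg} p.
Arguments params {R L M A n sg} p.
Arguments params_in {R L M A n sg} p.

Section Types.
Context {R : realType} {L : signature R}.
Context {n : nat} (sg : 'I_n -> lsort L).

Definition peval (M N : structure L) (f : forall s, M s -> N s) (A : sset M)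
    (a : args N sg) (psi : pformula A sg) : R :=
  eval (pbody psi) (apair a (amap f (params psi))).

(** A complete type over [A] is given by its values at the formulae over [A];
    it is realised in some elementary extension of [M]. *)
Record ctype (M : structure L) (A : sset M) := CType {
  tval :> pformula A sg -> R;
  tvalP : exists (N : structure L) (f : elem_emb M N) (a : args N sg),
    forall psi, tval psi = peval f a psi }.

End Types.

Section TypeSpace.
Context {R : realType} {L : signature R} {n : nat} {sg : 'I_n -> lsort L}.
Context {M : structure L} {A : sset M}.

HB.instance Definition _ := gen_eqMixin (ctype sg A).
HB.instance Definition _ := gen_choiceMixin (ctype sg A).
HB.instance Definition _ := Topological.copy (ctype sg A)
  (sup_topology (fun psi : pformula A sg => Topological.on
    (initial_topology (fun p : ctype sg A => p psi : R)))).

Lemma tp_subproof (a : args M sg) :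
  exists (N : structure L) (f : elem_emb M N) (a' : args N sg),
    forall psi : pformula A sg, peval (emb_id M) a psi = peval f a' psi.
Proof. by exists M, (emb_id M), a. Qed.

Definition tp (a : args M sg) : ctype sg A := CType (tp_subproof a).

Definition cont01 (X : topologicalType) (F : X -> R) : Prop :=
  continuous F /\ forall x, 0 <= F x <= 1.

End TypeSpace.

Arguments tp {R L n sg M} A a.

Section Pullback.
Context {R : realType} {L : signature R} {n : nat} {sg : 'I_n -> lsort L}.
Context {M N : structure L} (f : elem_emb M N) {A : sset M} {B : sset N}.
Hypothesis fAB : smaps f A B.

Definition pf_map (psi : pformula A sg) : pformula B sg :=
  @PFormula _ _ _ B _ sg _ _ (pbody psi) (amap f (params psi))
    (fun i => fAB (params_in psi i)).

Lemma pull_subproof (q : ctype sg B) :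
  exists (P : structure L) (g : elem_emb M P) (a : args P sg),
    forall psi : pformula A sg, q (pf_map psi) = peval g a psi.
Proof.
have [P [g [a qE]]] := tvalP q.
by exists P, (emb_comp g f), a => psi; rewrite qE.
Qed.

(** The type over [A] whose value at [psi x c] is that of [q] at
    [psi x (f c)]. *)
Definition pull (q : ctype sg B) : ctype sg A := CType (pull_subproof q).

End Pullback.

Definition tres (R : realType) (L : signature R) (n : nat)
    (sg : 'I_n -> lsort L) (M : structure L) (A : sset M)
    (q : ctype sg (sfull M)) : ctype sg A :=
  pull (f := emb_id M) (fun s a _ => I) q.

Section LocalTypes.
Context {R : realType} {L : signature R} {n m : nat}.
Context {sg : 'I_n -> lsort L} {ta : 'I_m -> lsort L}.
Variable phi : formula (csum sg ta).

Definition pinst (M : structure L) (b : args M ta) : pformula (sfull M) sg :=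
  @PFormula _ _ M (sfull M) _ sg _ _ phi b (fun=> I).

Definition phi_equiv (M : structure L) (p q : ctype sg (sfull M)) : bool :=
  `[< forall b : args M ta, p (pinst b) = q (pinst b) >].

Lemma phi_equiv_is_equiv (M : structure L) :
  equiv_class_of (@phi_equiv M).
Proof.
split=> [p|p q|q p r]; first exact/asboolP.
  by apply/asboolP/asboolP => + b => /(_ b).
by move=> /asboolP pq /asboolP qr; apply/asboolP => b; rewrite pq.
Qed.

Canonical phi_equiv_rel (M : structure L) :=
  EquivRelPack (phi_equiv_is_equiv M).

Definition Sphi (M : structure L) :=
  quotient_topology {eq_quot (phi_equiv_rel M)}.

Definition phi_val (M : structure L) (p : Sphi M) (b : args M ta) : R :=
  repr p (pinst b).

Lemma phi_val_pi (M : structure L) (q : ctype sg (sfull M)) (b : args M ta) :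
  phi_val (\pi_(Sphi M) q) b = q (pinst b).
Proof.
have /eqmodP/asboolP : repr (\pi_(Sphi M) q) = q %[mod {eq_quot phi_equiv_rel M}].
  exact: (reprK (\pi_(Sphi M) q)).
exact.
Qed.

(** Restriction along an elementary embedding of models, and (for an
    automorphism) the action of the latter on local types. *)
Definition Sphi_pull (M N : structure L) (f : elem_emb M N) (p : Sphi N) :
  Sphi M := \pi_(Sphi M) (pull (f := f) (fun s a _ => I) (repr p)).

Definition is_definition (M : structure L) (p : Sphi M)
    (psi : ctype ta (sfull M) -> R) : Prop :=
  cont01 psi /\ forall b : args M ta, phi_val p b = psi (tp (sfull M) b).

Definition definable_over (M : structure L) (A : sset M) (p : Sphi M) : Prop :=
  exists2 psi : ctype ta (sfull M) -> R, is_definition p psi &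
    exists2 g : ctype ta A -> R, cont01 g & forall q, psi q = g (tres A q).

(** Here [N] is the monster model. *)
Definition phi_predicate (N : structure L) (A : sset N) (F : Sphi N -> R) :
    Prop :=
  cont01 F /\
  forall g : automorphism N, (forall s (a : N s), A s a -> g s a = a) ->
    forall p, F (Sphi_pull (emb_aut g) p) = F p.

Definition over_equiv (N : structure L) (A : sset N) (p q : Sphi N) : bool :=
  `[< forall F, phi_predicate A F -> F p = F q >].

Lemma over_equiv_is_equiv (N : structure L) (A : sset N) :
  equiv_class_of (@over_equiv N A).
Proof.
split=> [p|p q|q p r]; first exact/asboolP.
  by apply/asboolP/asboolP => + F HF => /(_ F HF).
by move=> /asboolP pq /asboolP qr; apply/asboolP => F HF; rewrite pq ?qr.
Qed.

Canonical over_equiv_rel (N : structure L) (A : sset N) :=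
  EquivRelPack (over_equiv_is_equiv A).

Definition Sphi_over (N : structure L) (A : sset N) :=
  quotient_topology {eq_quot (over_equiv_rel A)}.

(** The graph of the restriction map from [Sphi M] to [Sphi_over A], for [A]
    a subset of [M] and [i] an embedding of [M] in the monster model. *)
Definition restricts_to (M N : structure L) (i : elem_emb M N) (A : sset M)
    (p : Sphi M) (q : Sphi_over (simage i A)) : Prop :=
  exists2 r : Sphi N, Sphi_pull i r = p & \pi_(Sphi_over (simage i A)) r = q.

End LocalTypes.

Section Monster.
Context {R : realType} {L : signature R}.

(** The cardinality of [X] is less than that of [K]. *)
Definition small (K X : Type) : Prop := ~ ([set: K] #<= [set: X]).

Definition saturated (K : Type) (N : structure L) : Prop :=
  forall A : sset N, small K {x : {s & N s} | A (projT1 x) (projT2 x)} ->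
  forall n (sg : 'I_n -> lsort L) (p : ctype sg A), exists a, p = tp A a.

Definition strongly_homogeneous (K : Type) (N : structure L) : Prop :=
  forall (I : Type) (sg : I -> lsort L) (a b : args N sg), small K I ->
    (forall psi : formula sg, eval psi a = eval psi b) ->
    exists g : automorphism N, forall i, g _ (a i) = b i.

Definition all_formulae : Type :=
  {n : nat & {sg : 'I_n -> lsort L & formula sg}}.

(** The cardinal of [K] is larger than that of the language, in particular
    uncountable. *)
Definition monster (K : Type) (N : structure L) : Prop :=
  [/\ small K all_formulae, saturated K N & strongly_homogeneous K N].

Definition acl (N : structure L) (A : sset N) : sset N :=
  fun s => [set b | compact [set c : N s | tp A (aone c) = tp A (aone b)]].

Definition algebraically_closed (N : structure L) (A : sset N) : Prop :=
  A = acl A.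

End Monster.

(* Main.v *)
Require Import Defs.
From HB Require Import structures.
From mathcomp Require Import all_boot all_order all_algebra.
From mathcomp Require Import all_classical all_reals all_analysis.
From mathcomp Require Import lra.
(* The libraries above also use some of these names, such as [eval]. *)
Import Defs.

(** Fix [b0] in [M] and write [s] and [s'] for the values of [phi x b0] at [p]
    and [p'].  The proof produces a [phi]-predicate over [A] whose value is [s]
    at every extension of [p] to the monster model [N], and [s'] at every
    extension of [p'].  As [p] and [p'] have the same restriction to [A], this
    gives [s = s'] for every [b0], hence [p = p'].

    The predicate.  The functions [phi x b] on tuples [x] of [N], for [b] in the
    orbit of [b0] under the automorphisms over [A], have a pointwise closure that
    is compact and invariant.  Let [Y] be a minimal nonempty closed invariant
    subset of it ([minimal_subflow]).  Stability implies that on some nonempty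
    open piece of [Y] all the functions are uniformly continuous with respect to
    the same finitely many instances of [phi] ([open_piece]): otherwise one
    builds sequences along which the two iterated limits of [phi] differ, against
    [double_limit].  By minimality every orbit in [Y] visits that piece, and by
    compactness the whole of [Y] is equicontinuous
    ([minimal_equicontinuous]).  The supremum of [Y] is therefore invariant and
    uniformly continuous in terms of the values of [phi], so that it extends to a
    continuous invariant function of the local type ([ext_predicate]).

    Its value.  Let [r] extend [p].  By saturation some [a1] in [N] realises [r]
    over [M] and finitely many parameters that control the supremum.  An
    ultrafilter on the tuples of [M] converges to the type of [a1] over [M]; its
    limit in the ultrapower of [N] is a type over [N] that is finitely
    satisfiable in [M] ([ultralimit_type]), and it is realised, over the same
    parameters, by some [a2].  As [a1] and [a2] have the same type over [M], they
    are conjugate over [A] and the supremum takes the same value at both.  At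
    [a2] this value is approximated by values at tuples of [M], and there the
    interchange of limits for [phi] in [M], together with the definition of [p]
    over [A], which is constant on the orbit of [b0], shows that every function
    in [Y] tends to [s] ([coheir_value], [ext_value_at]). *)

Set Implicit Arguments.
Unset Strict Implicit.
Unset Printing Implicit Defensive.

Import Order.TTheory GRing.Theory Num.Theory.
Import numFieldNormedType.Exports.

Local Open Scope classical_set_scope.
Local Open Scope card_scope.
Local Open Scope quotient_scope.
Local Open Scope ring_scope.

(** * Limits along ultrafilters and double limits *)

Lemma filter_meet (T : Type) (F : set_system T) (FF : ProperFilter F)
  (P Q : set T) : F P -> F Q -> exists2 x, P x & Q x.
Proof. by move=> FP FQ; have [x []] := filter_ex (filterI FP FQ); exists x. Qed.

Section Ultralimits.
Context {R : realType} {T : Type} (U : set_system T).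

Lemma cvg_distP {FF : Filter U} (f : T -> R) (l : R) :
  f @ U --> l <-> forall e, 0 < e -> U [set x | `|f x - l| < e].
Proof.
split=> [/cvgrPdist_lt fl e /fl|fl].
  by apply: filterS => x /=; rewrite distrC.
by apply/cvgrPdist_lt => e /fl; apply: filterS => x /=; rewrite distrC.
Qed.

(** Compactness of the unit interval: a cluster point along an ultrafilter is a
    limit. *)
Lemma ultra_bounded_cvg (UU : UltraFilter U) (f : T -> R) :
  U [set x | 0 <= f x <= 1] -> exists2 l : R, f @ U --> l & 0 <= l <= 1.
Proof.
move=> f01; have PU : ProperFilter U := @ultra_proper _ _ UU.
have /(_ (f @ U) _) := @segment_compact R 0 1.
case=> [|l [/= l01 lU]].
  by apply: (@filterS _ U _ _ _ _ f01) => x /= f01x; rewrite in_itv.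
exists l; last by move: l01; rewrite in_itv.
apply/cvg_distP => e e0.
have [//|Un] := in_ultra_setVsetC [set x | `|f x - l| < e] UU.
have [y [[x xn <-] yb]] := lU (f @` ~` [set x | `|f x - l| < e]) (ball l e)
  (filterS (fun x xn => ex_intro2 _ _ x xn erefl) Un) (nbhsx_ballx _ _ e0).
by exfalso; apply: xn; rewrite /= distrC.
Qed.

Lemma cvg_ge_lim {FF : ProperFilter U} (f : T -> R) (l c : R) :
  f @ U --> l -> U [set x | c <= f x] -> c <= l.
Proof.
move=> /cvg_distP fl fc; rewrite leNgt; apply/negP => lc.
have lc0 : 0 < c - l by lra.
have [x /= + cx] := filter_meet FF (fl _ lc0) fc.
by rewrite ltr_distlC; lra.
Qed.

Lemma cvg_le_lim {FF : ProperFilter U} (f : T -> R) (l c : R) :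
  f @ U --> l -> U [set x | f x <= c] -> l <= c.
Proof.
move=> fl fc; rewrite -lerN2; apply: (@cvg_ge_lim _ (fun x => - f x)).
  exact: cvgN.
by apply: filterS fc => x; rewrite /= lerN2.
Qed.

End Ultralimits.

Section ListBounds.
Context {R : realType} {T : Type}.

Lemma list_min_gt0 (c : T -> R) (l : seq T) :
  (forall x, List.In x l -> 0 < c x) ->
  exists2 d, 0 < d & forall x, List.In x l -> d <= c x.
Proof.
elim: l => [|x l IH] cl; first by exists 1.
have [|d d0 dl] := IH; first by move=> y yl; apply: cl; right.
exists (Num.min d (c x)); first by rewrite lt_min d0 cl//; left.
by move=> y [<-|/dl dy]; rewrite ge_min ?lexx ?orbT// dy.
Qed.

Lemma filter_list (S : Type) (F : set_system S) (FF : Filter F)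
  (P : T -> S -> Prop) (l : seq T) :
  (forall x, List.In x l -> F (P x)) ->
  F [set y | forall x, List.In x l -> P x y].
Proof.
elim: l => [|x l IH] Pl; first by apply: filterS filterT => y _ x [].
have Fx : F (P x) by apply: Pl; left.
have Fl := IH (fun y yl => Pl y (or_intror yl)).
apply: filterS (filterI Fx Fl) => y [Pxy Ply] z [<-//|]; exact: Ply.
Qed.

End ListBounds.

Section Lists.
Context {T S : Type}.

Lemma In_flatten (F : T -> seq S) (l : seq T) x y :
  List.In x l -> List.In y (F x) -> List.In y (flatten [seq F z | z <- l]).
Proof.
move=> + yx; elim: l => //= z l IH [->|/IH ?];
  apply/List.in_or_app; [by left|by right].
Qed.

Lemma In_pmap (f : T -> option S) (l : seq T) x y :
  List.In x l -> f x = Some y -> List.In y (pmap f l).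
Proof.
move=> + fx; elim: l => //= z l IH [->|/IH yl]; first by rewrite fx; left.
by case: (f z) => //= ?; right.
Qed.

Lemma In_tnth (l : seq T) (x : T) : List.In x l ->
  exists j : 'I_(size l), tnth (in_tuple l) j = x.
Proof.
elim: l => //= y l IH [->|/IH[j jx]].
  by exists ord0; rewrite (tnth_nth x).
exists (lift ord0 j).
by rewrite -jx !(tnth_nth x).
Qed.

End Lists.

Lemma In_enum n (v : 'I_n) : List.In v (enum 'I_n).
Proof.
have : v \in enum 'I_n by rewrite mem_enum.
elim: (enum _) => //= x s IH; rewrite inE => /orP[/eqP ->|/IH]; first by left.
by right.
Qed.

Section PowersOfTwo.
Context {R : realType}.

Lemma exp2V_gt0 (k : nat) : 0 < 2 ^- k :> R.
Proof. by rewrite invr_gt0 exprn_gt0. Qed.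

Lemma exp2VS (k : nat) : 2 * 2 ^- k.+1 = 2 ^- k :> R.
Proof. by rewrite exprS invfM mulrA divff ?mul1r. Qed.

Lemma exp2V_small (e : R) : 0 < e -> exists k, 2 ^- k < e.
Proof.
move=> e0; have /cvg_geometric : `|2^-1| < 1 :> R.
  by rewrite ger0_norm ?invr_ge0//; lra.
move=> /(_ 1) /cvgrPdist_lt/(_ e e0)[k _ /(_ k (leqnn k))] /=.
rewrite sub0r normrN mul1r normrX ger0_norm ?invr_ge0// exprVn => ke.
by exists k.
Qed.

End PowersOfTwo.

(** Values that can be approximated finitely many at a time are attained
    simultaneously in the limit along an ultrafilter. *)
Section ApproximationUltrafilter.
Context {R : realType} {S T : Type}.

Lemma ultrafilter_of_approx (f : T -> S -> R) (c : T -> R) :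
  (forall l d, 0 < d ->
    exists a, forall x, List.In x l -> `|f x a - c x| < d) ->
  exists2 W : set_system S, UltraFilter W &
    forall x, f x a @[a --> W] --> c x.
Proof.
move=> approx.
pose near (y : seq T * R) : set S :=
  [set a | forall x, List.In x y.1 -> `|f x a - c x| < y.2].
have PF : ProperFilter (filter_from [set y | 0 < y.2] near).
  apply: filter_from_proper; last by move=> [l d]; exact: approx.
  apply: filter_from_filter; first by exists ([::], 1) => /=.
  move=> [l d] [l' d'] /= d0 d'0; exists (l ++ l', Num.min d d').
    by rewrite /= lt_min d0.
  move=> a aP; split=> x xl.
    have /aP : List.In x (l ++ l') by apply/List.in_or_app; left.
    by rewrite /= lt_min => /andP[].
  have /aP : List.In x (l ++ l') by apply/List.in_or_app; right.
  by rewrite /= lt_min => /andP[].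
have [W [WW FW]] := ultraFilterLemma PF.
have PW : ProperFilter W := @ultra_proper _ _ WW.
exists W => // x; apply/cvg_distP => d d0; apply: FW.
by exists ([:: x], d) => //= a; apply; left.
Qed.

End ApproximationUltrafilter.

Section History.

(** Dependent choice in which every step may look at all the earlier ones. *)
Lemma history_choice (X : Type) (P : seq X -> X -> Prop) :
  (forall l, exists x, P l x) ->
  exists u : nat -> X, forall k, P [seq u i | i <- iota 0 k] (u k).
Proof.
move=> /choice[f fP].
pose h := fix h k := if k is k'.+1 then rcons (h k') (f (h k')) else [::].
exists (fun k => f (h k)) => k.
have -> : [seq f (h i) | i <- iota 0 k] = h k.
  elim: k => [//|k IH]; rewrite -{1}(addn1 k) iotaD map_cat IH.
  by rewrite /= add0n cats1.
exact: fP.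
Qed.

Lemma In_history (X : Type) (u : nat -> X) i k : (i < k)%N ->
  List.In (u i) [seq u j | j <- iota 0 k].
Proof.
elim: k => [//|k IH]; rewrite ltnS leq_eqVlt -(addn1 k) iotaD map_cat /= add0n.
move=> ik; apply/List.in_or_app; case/orP: ik => [/eqP ->|/IH]; last by left.
by right; left.
Qed.

End History.

Section Stable.
Context {R : realType}.

(** What stability says about the function that a formula defines in a single
    model; the analytic arguments below use nothing else about it. *)
Definition stable_fun (E B : Type) (Phi : E -> B -> R) : Prop :=
  forall e, 0 < e -> ~ exists (a : nat -> E) (b : nat -> B),
    forall i j, (i < j)%N -> e <= `|Phi (a i) (b j) - Phi (a j) (b i)|.

Lemma stable_comp (E B I J : Type) (Phi : E -> B -> R) (a : I -> E)
  (b : J -> B) : stable_fun Phi -> stable_fun (fun i j => Phi (a i) (b j)).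
Proof.
by move=> st e /st nst [i [j ij]]; apply: nst; exists (a \o i), (b \o j).
Qed.

(** If the limits were different, one could choose the pairs [(a_k, b_k)] one
    after the other, each close enough to the limits with respect to the earlier
    ones: then [Phi a_i b_j] is near [t] and [Phi a_j b_i] is near [s] for all
    [i < j], against stability. *)
Lemma double_limit (E B : Type) (Phi : E -> B -> R) (F : set_system E)
  (G : set_system B) (FF : ProperFilter F) (GG : ProperFilter G)
  (f : B -> R) (h : E -> R) (s t : R) :
  stable_fun Phi ->
  (forall b, Phi a b @[a --> F] --> f b) ->
  (forall a, Phi a b @[b --> G] --> h a) ->
  f @ G --> s -> h @ F --> t -> s = t.
Proof.
move=> st Ff Gh Gs Ft; apply/eqP/negPn/negP => sNt.
pose e := `|s - t| / 5; have e0 : 0 < e.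
  by rewrite divr_gt0// normr_gt0 subr_eq0.
pose P (l : seq (E * B)) (x : E * B) :=
  [/\ `|h x.1 - t| < e, `|f x.2 - s| < e,
     forall y, List.In y l -> `|Phi x.1 y.2 - f y.2| < e &
     forall y, List.In y l -> `|Phi y.1 x.2 - h y.1| < e].
have /history_choice[u uP] : forall l, exists x, P l x.
  move=> l.
  have /filter_ex[a [ha la]] : F ([set a | `|h a - t| < e] `&`
      [set a | forall y, List.In y l -> `|Phi a y.2 - f y.2| < e]).
    apply: filterI; first by have /cvg_distP := Ft; exact.
    by apply: filter_list => y _; have /cvg_distP := Ff y.2; exact.
  have /filter_ex[b [fb lb]] : G ([set b | `|f b - s| < e] `&`
      [set b | forall y, List.In y l -> `|Phi y.1 b - h y.1| < e]).
    apply: filterI; first by have /cvg_distP := Gs; exact.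
    by apply: filter_list => y _; have /cvg_distP := Gh y.1; exact.
  by exists (a, b).
apply: (st e e0); exists (fst \o u), (snd \o u) => i j ij /=.
have [hi fi _ _] := uP i.
have [_ _ /(_ _ (In_history u ij)) Fj /(_ _ (In_history u ij)) Gj] := uP j.
have st5 : `|s - t| = 5 * e by rewrite /e mulrC divfK.
have : `|s - t| <= `|f (u i).2 - s| + `|Phi (u j).1 (u i).2 - f (u i).2| +
    `|Phi (u i).1 (u j).2 - Phi (u j).1 (u i).2| +
    `|Phi (u i).1 (u j).2 - h (u i).1| + `|h (u i).1 - t|.
  rewrite -(normrN (f _ - s)) -(normrN (Phi _ _ - f _)).
  rewrite -(normrN (Phi (u i).1 _ - Phi _ _)).
  rewrite [X in X <= _](_ : _ = `|- (f (u i).2 - s) -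
    (Phi (u j).1 (u i).2 - f (u i).2) -
    (Phi (u i).1 (u j).2 - Phi (u j).1 (u i).2) +
    (Phi (u i).1 (u j).2 - h (u i).1) + (h (u i).1 - t)|); last first.
    congr `|_|; lra.
  do 4 (apply: le_trans (ler_normD _ _) _; rewrite lerD2r//).
lra.
Qed.

(** Along an ultrafilter all the limits exist, so that the two iterated limits
    of a stable function agree. *)
Lemma double_limit_seq (V : set_system nat) (VV : UltraFilter V)
    (Phi : nat -> nat -> R) :
  stable_fun Phi -> (forall i j, 0 <= Phi i j <= 1) ->
  exists (f h : nat -> R) (s : R),
    [/\ forall k, Phi j k @[j --> V] --> f k,
        forall j, Phi j k @[k --> V] --> h j, f @ V --> s & h @ V --> s].
Proof.
move=> st Phi01; have PV : ProperFilter V := @ultra_proper _ _ VV.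
have /choice[f fP] : forall k, exists l : R,
    Phi j k @[j --> V] --> l /\ 0 <= l <= 1.
  move=> k; have [|l ? ?] := @ultra_bounded_cvg R _ V VV (Phi ^~ k).
    by apply: filterS filterT => j _; exact: Phi01.
  by exists l.
have /choice[h hP] : forall j, exists l : R,
    Phi j k @[k --> V] --> l /\ 0 <= l <= 1.
  move=> j; have [|l ? ?] := @ultra_bounded_cvg R _ V VV (Phi j).
    by apply: filterS filterT => k _; exact: Phi01.
  by exists l.
have [|s fs _] := @ultra_bounded_cvg R _ V VV f.
  by apply: filterS filterT => k _; have [] := fP k.
have [|t ht _] := @ultra_bounded_cvg R _ V VV h.
  by apply: filterS filterT => k _; have [] := hP k.
exists f, h, s; split => //; [by move=> k; have [] := fP k
  |by move=> j; have [] := hP j|].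
rewrite (@double_limit _ _ Phi V V PV PV f h s t) //.
  by move=> k; have [] := fP k.
by move=> j; have [] := hP j.
Qed.

End Stable.

(** * Equicontinuity of minimal flows *)

Section Pointwise.
Context {R : realType} {E B : Type} (Phi : E -> B -> R).

(** The constant 3 leaves room for approximations: in [open_piece], a variation
    of [h] by more than [3 * e] gives instances of [Phi] that vary by at least
    [2 * e], well apart from [e]. *)
Definition uc_on (l : seq B) (e : R) (h : E -> R) : Prop :=
  forall a a', (forall b, List.In b l -> `|Phi a b - Phi a' b| <= e) ->
    `|h a - h a'| <= 3 * e.

Lemma uc_onS (l l' : seq B) e h :
  (forall b, List.In b l -> List.In b l') -> uc_on l e h -> uc_on l' e h.
Proof. by move=> ll' hl a a' aa'; apply: hl => b /ll'; exact: aa'. Qed.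

Definition near_on (l : seq E) (d : R) (h k : E -> R) : Prop :=
  forall a, List.In a l -> `|h a - k a| < d.

(** The closure in the product topology, spelt out on finite sets of points:
    its compactness is then just the convergence of bounded reals along
    ultrafilters. *)
Definition pclosure (Y : set (E -> R)) : set (E -> R) :=
  [set h | forall l d, 0 < d -> exists2 k, Y k & near_on l d k h].

Lemma pclosure01 (Y : set (E -> R)) :
  (forall h, Y h -> forall a, 0 <= h a <= 1) ->
  forall h, pclosure Y h -> forall a, 0 <= h a <= 1.
Proof.
move=> Y01 h hY a; have h01 d : 0 < d -> - d <= h a <= 1 + d.
  move=> d0; have [k Yk /(_ a (or_introl erefl))] := hY [:: a] d d0.
  by have := Y01 k Yk a; rewrite ltr_distl; lra.
by apply/andP; split; apply/ler_addgt0Pl => d /h01 /andP[]; lra.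
Qed.

Lemma pclosure_idem (X : set (E -> R)) : pclosure (pclosure X) `<=` pclosure X.
Proof.
move=> h hX l d d0; have d2 : 0 < d / 2 by lra.
have [k kX kh] := hX l _ d2; have [k' Xk' k'k] := kX l _ d2.
exists k' => // a al; have := kh a al; have := k'k a al.
by have := ler_distD (k a) (k' a) (h a); lra.
Qed.

(** If every open piece contained, for every finite [beta], a function that is
    not controlled by [beta], one could choose successively smaller pieces, pairs
    [a_k, a'_k] that are [e]-close on the earlier [b_j] but [3 * e] apart for all
    the functions in the current piece, and [b_k] approximating one of them on
    the earlier points.  The two iterated limits of [Phi a_j b_k - Phi a'_j b_k]
    would then be at most [e] and at least [2 * e]. *)
Lemma open_piece (Y : set (E -> R)) (e : R) :
  stable_fun Phi -> (forall a b, 0 <= Phi a b <= 1) ->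
  Y `<=` pclosure (range (fun b => Phi ^~ b)) -> Y !=set0 -> 0 < e ->
  exists (beta : seq B) (l : seq E) (d : R) (h0 : E -> R),
    [/\ 0 < d, Y h0 &
      forall h, Y h -> near_on l d h h0 -> uc_on beta e h].
Proof.
move=> st Phi01 Yapp [hY YhY] e0; apply: contrapT => no.
have far (beta : seq B) l d h0 : 0 < d -> Y h0 -> exists h a a',
    [/\ Y h, near_on l d h h0,
      forall b, List.In b beta -> `|Phi a b - Phi a' b| <= e &
      3 * e < h a - h a'].
  move=> d0 Yh0; apply: contrapT => noh; apply: no; exists beta, l, d, h0.
  split=> // h Yh hh0 a a' aa'; rewrite leNgt; apply/negP => haa'.
  apply: noh; have [H|H] := lerP 0 (h a - h a').
    by rewrite (ger0_norm H) in haa'; exists h, a, a'.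
  exists h, a', a; split => //; first by move=> b /aa'; rewrite distrC.
  by rewrite (ltr0_norm H) opprB in haa'.
(* [inv l] says that the piece cut out by the triples in [l] is nonempty. *)
pose inv (l : seq (E * E * B)) := exists2 h, Y h &
  forall x, List.In x l -> 3 * e < h x.1.1 - h x.1.2.
pose P (l : seq (E * E * B)) (x : E * E * B) := inv l ->
  [/\ inv (rcons l x),
      forall y, List.In y l -> `|Phi x.1.1 y.2 - Phi x.1.2 y.2| <= e &
      forall y, List.In y l -> 2 * e <= Phi y.1.1 x.2 - Phi y.1.2 x.2].
have step l : inv l -> exists x, P l x.
  move=> [h0 Yh0 lh0].
  have [|d d0 dl] := @list_min_gt0 R _ (fun x : E * E * B =>
      (h0 x.1.1 - h0 x.1.2 - 3 * e) / 2) l.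
    by move=> x /lh0; lra.
  pose pts := [seq x.1.1 | x <- l] ++ [seq x.1.2 | x <- l].
  have pts1 x : List.In x l -> List.In x.1.1 pts.
    move=> xl; apply/List.in_or_app; left.
    exact: (List.in_map (fun y : E * E * B => y.1.1)).
  have pts2 x : List.In x l -> List.In x.1.2 pts.
    move=> xl; apply/List.in_or_app; right.
    exact: (List.in_map (fun y : E * E * B => y.1.2)).
  have [h [a [a' [Yh hh0 aa' haa']]]] :=
    far [seq x.2 | x <- l] pts d h0 d0 Yh0.
  have e4 : 0 < e / 2 by lra.
  have [_ [b _ <-] bh] := Yapp h Yh pts (e / 2) e4.
  have hl x : List.In x l -> 3 * e < h x.1.1 - h x.1.2.
    move=> xl; move: (hh0 _ (pts1 _ xl)) (hh0 _ (pts2 _ xl)) (dl _ xl).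
    rewrite !ltr_distl => /andP[? ?] /andP[? ?] ?; lra.
  exists (a, a', b) => _; split => /=.
  - exists h => // x; rewrite -cats1.
    by move=> /(@List.in_app_or _ _ _ _)[/hl //|[<-|[]]].
  - by move=> y yl; apply: aa'; exact: (List.in_map snd).
  - move=> y yl; move: (bh _ (pts1 _ yl)) (bh _ (pts2 _ yl)) (hl _ yl).
    rewrite !ltr_distl => /andP[? ?] /andP[? ?] ?; lra.
have inv0 : inv [::] by exists hY.
have [x0 _] := step _ inv0.
have /history_choice[u uP] : forall l, exists x, P l x.
  move=> l; have [/step //|nl] := pselect (inv l).
  by exists x0 => /nl.
have invk k : inv [seq u i | i <- iota 0 k].
  elim: k => [//|k IH]; rewrite -(addn1 k) iotaD map_cat /= add0n cats1.
  by have [] := uP k IH.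
pose a j := (u j).1.1; pose a' j := (u j).1.2; pose b j := (u j).2.
have close j k : (j < k)%N -> `|Phi (a k) (b j) - Phi (a' k) (b j)| <= e.
  by move=> jk; have [_ + _] := uP k (invk k); apply; exact: In_history.
have apart j k : (j < k)%N -> 2 * e <= Phi (a j) (b k) - Phi (a' j) (b k).
  by move=> jk; have [_ _] := uP k (invk k); apply; exact: In_history.
have [V [VV ooV]] := @ultraFilterLemma nat \oo _.
have PV : ProperFilter V := @ultra_proper _ _ VV.
have gtV j : V [set k | (j < k)%N] by apply: ooV; exists j.+1.
have [f1 [h1 [s1 [f1P h1P f1s h1s]]]] :=
  @double_limit_seq R V VV _ (stable_comp (a := a) (b := b) st) (fun i j => Phi01 _ _).
have [f2 [h2 [s2 [f2P h2P f2s h2s]]]] :=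
  @double_limit_seq R V VV _ (stable_comp (a := a') (b := b) st) (fun i j => Phi01 _ _).
have lo : 2 * e <= s1 - s2.
  apply: (@cvg_ge_lim _ _ V PV (fun j => h1 j - h2 j)); first exact: cvgB.
  apply: filterS filterT => j _ /=.
  apply: (@cvg_ge_lim _ _ V PV _ _ _ (cvgB (h1P j) (h2P j))).
  by apply: filterS (gtV j) => k; exact: apart.
have hi : s1 - s2 <= e.
  apply: (@cvg_le_lim _ _ V PV (fun k => f1 k - f2 k)); first exact: cvgB.
  apply: filterS filterT => k _ /=.
  apply: (@cvg_le_lim _ _ V PV _ _ _ (cvgB (f1P k) (f2P k))).
  by apply: filterS (gtV k) => j /close; apply: le_trans (ler_norm _).
lra.
Qed.

Context (G : set (E -> E)).
Hypothesis Gid : G id.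
Hypothesis Gcomp : forall g g', G g -> G g' -> G (g \o g').

Definition subflow (Y : set (E -> R)) : Prop :=
  [/\ Y !=set0, pclosure Y `<=` Y, (forall h, Y h -> forall a, 0 <= h a <= 1) &
      forall g h, G g -> Y h -> Y (h \o g)].

(** Compactness of a closed set of functions with values in the unit interval;
    the limit lies in every closed set that the ultrafilter contains. *)
Lemma pointwise_ultralimit (X : set (E -> R)) (W : set_system (E -> R)) :
  subflow X -> UltraFilter W -> W X -> exists h,
    (forall a, k a @[k --> W] --> h a) /\
    forall Y, pclosure Y `<=` Y -> W Y -> Y h.
Proof.
move=> [_ _ X01 _] WW WX; have PW : ProperFilter W := @ultra_proper _ _ WW.
have /choice[h hP] : forall a, exists l : R, k a @[k --> W] --> l.
  move=> a; have [|l ? _] := @ultra_bounded_cvg R _ W WW (fun k => k a).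
    by apply: filterS WX => k /X01/(_ a).
  by exists l.
exists h; split => // Y Ycl WY; apply: Ycl => l d d0.
have Wl : W [set k | near_on l d k h].
  apply: filter_list => a _.
  by have /cvg_distP := hP a; exact.
by have [k Yk kh] := filter_meet PW WY Wl; exists k.
Qed.

(** Zorn's lemma, applied to the complements; a chain of closed nonempty sets
    has nonempty intersection by compactness. *)
Lemma minimal_subflow (X : set (E -> R)) : subflow X ->
  exists Y, [/\ Y `<=` X, subflow Y & forall Z, Z `<=` Y -> subflow Z -> Z = Y].
Proof.
move=> sX; have [Xn Xcl X01 XG] := sX.
have [|A [PA Amax]] := @Zorn_bigcup (E -> R) (fun C => subflow (X `\` C)).
  move=> F FP Ftot.
  have [->|/set0P[C0 FC0]] := eqVneq F set0; first by rewrite bigcup_set0 setD0.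
  split.
  - have PF : ProperFilter (filter_from F (fun C => X `\` C)).
      apply: filter_from_proper; last by move=> C /FP[].
      apply: filter_from_filter; first by exists C0.
      move=> C C' FC FC'; have [CC'|CC'] := Ftot _ _ FC FC'.
        by exists C' => // h [Xh nC'h]; split => //; split => // /CC'.
      by exists C => // h [Xh nC'h]; split => //; split => // /CC'.
    have [W [WW FW]] := ultraFilterLemma PF.
    have WF C : F C -> W (X `\` C) by move=> FC; apply: FW; exists C.
    have PW : ProperFilter W := @ultra_proper _ _ WW.
    have WX : W X by apply: filterS (WF _ FC0) => h [].
    have [h [_ hY]] := pointwise_ultralimit sX WW WX.
    exists h; split; first exact: hY.
    by move=> [C FC Ch]; have [_ + _ _] := FP _ FC => /hY /(_ (WF _ FC))[].
  - move=> h hcl; have Fh C : F C -> (X `\` C) h.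
      move=> FC; have [_ + _ _] := FP _ FC; apply => l d /(hcl l d)[k].
      by move=> [Xk nk]; exists k => //; split => // Ck; apply: nk; exists C.
    by split => [|[C FC Ch]]; [have [] := Fh _ FC0|have [_] := Fh _ FC].
  - by move=> h [/X01].
  - move=> g h Gg [Xh nh]; split; first exact: XG.
    move=> [C FC Chg]; have [_ _ _ /(_ g h Gg)] := FP _ FC.
    by case=> //; split => // Ch; apply: nh; exists C.
exists (X `\` A); split => [h []//|//|Z ZY sZ]; apply: contrapT => ZnY.
have ZX : X `\` (~` Z) = Z.
  by rewrite setDE setCK; apply: setIidr => h /ZY[].
suff /Amax : A `<` ~` Z by rewrite ZX; apply.
rewrite properEneq; split; last by move=> h Ah /ZY[].
by apply/eqP => AZ; apply: ZnY; rewrite AZ ZX.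
Qed.

Hypothesis GPhi : forall g, G g -> forall b, exists b', forall a,
  Phi (g a) b = Phi a b'.
Hypothesis Ginv : forall g, G g -> exists2 g', G g' & cancel g' g.

(** Translating a function amounts to translating the parameters that control
    it. *)
Lemma uc_on_translate g e beta : G g -> exists beta', forall h,
  uc_on beta e (h \o g) -> uc_on beta' e h.
Proof.
move=> /Ginv[g' Gg' gK]; have /choice[t tP] := GPhi Gg'.
exists [seq t b | b <- beta] => h hg a a' aa'.
rewrite -(gK a) -(gK a'); apply: hg => b bl; rewrite !tP; apply: aa'.
exact: List.in_map.
Qed.

(** The functions whose orbit avoids the piece of [open_piece] form a closed
    invariant proper subset of [Y], which is empty by minimality.  So every
    function in [Y] has a translate in the piece, and is controlled by a translate
    of [beta].  If no finite set controlled all of [Y], a limit of worse and worse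
    functions would have a translate in the piece; so would the functions near
    it, and they would all be controlled by the same parameters. *)
Lemma minimal_equicontinuous (Y : set (E -> R)) (e : R) :
  stable_fun Phi -> (forall a b, 0 <= Phi a b <= 1) ->
  Y `<=` pclosure (range (fun b => Phi ^~ b)) -> subflow Y ->
  (forall Z, Z `<=` Y -> subflow Z -> Z = Y) -> 0 < e ->
  exists beta, forall h, Y h -> uc_on beta e h.
Proof.
move=> st Phi01 Yapp sY Ymin e0; have [Yn Ycl Y01 YG] := sY.
have [beta [l [d [h0 [d0 Yh0 piece]]]]] := open_piece st Phi01 Yapp Yn e0.
have visit h : Y h -> exists2 g, G g & near_on l d (h \o g) h0.
  move=> Yh; apply: contrapT => nh.
  pose D := Y `&` [set k : E -> R | ~ exists2 g, G g & near_on l d (k \o g) h0].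
  have sD : subflow D.
    split; first by exists h.
    - move=> k kD; split.
        by apply: Ycl => l' d' /(kD l' d')[k' [Yk' _]]; exists k'.
      move=> [g Gg kg].
      have [|d' d'0 d'l] := @list_min_gt0 R _
          (fun a => d - `|k (g a) - h0 a|) l.
        by move=> a /kg; rewrite subr_gt0.
      have [k' [_ nk'] kk'] := kD [seq g a | a <- l] d' d'0.
      apply: nk'; exists g => // a al /=.
      have := kk' (g a) (List.in_map g _ _ al); have := d'l _ al.
      have := ler_distD (k (g a)) (k' (g a)) (h0 a); lra.
    - by move=> k [/Y01].
    - move=> g k Gg [Yk nk]; split; first exact: YG.
      by move=> [g' Gg' kg']; apply: nk; exists (g \o g') => //; exact: Gcomp.
  have DY : D = Y by apply: Ymin => // k [].
  have : D h0 by rewrite DY.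
  by case=> _; apply; exists id => // a _ /=; rewrite subrr normr0.
apply: contrapT => no.
(* The functions that a given finite set does not control. *)
pose bad beta := Y `&` [set h | ~ uc_on beta e h].
have PF : ProperFilter (filter_from setT bad).
  apply: filter_from_proper; last first.
    move=> b _; apply: contrapT => nb; apply: no; exists b => h Yh.
    by apply: contrapT => nh; apply: nb; exists h.
  apply: filter_from_filter; first by exists [::].
  move=> b b' _ _; exists (b ++ b') => // h [Yh nh].
  by split; split => // hb; apply: nh; apply: uc_onS hb => x xb;
    apply/List.in_or_app; [left|right].
have [W [WW FW]] := ultraFilterLemma PF.
have PW : ProperFilter W := @ultra_proper _ _ WW.
have Wbad b : W (bad b) by apply: FW; exists b.
have WY : W Y by apply: filterS (Wbad [::]) => h [].
have [h [hP /(_ _ Ycl WY) Yh]] := pointwise_ultralimit sY WW WY.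
have [g Gg hg] := visit _ Yh.
have [beta' tr] := @uc_on_translate g e beta Gg.
have Wg : W [set k : E -> R | near_on l d (k \o g) h0].
  apply: filter_list => a al; have da : 0 < d - `|h (g a) - h0 a|.
    by rewrite subr_gt0; exact: hg.
  have /cvg_distP/(_ _ da) := hP (g a); apply: filterS => k /= kd.
  have := ler_distD (h (g a)) (k (g a)) (h0 a); lra.
have [k [Yk nk] kg] := filter_meet PW (Wbad beta') Wg.
by apply: nk; apply: tr; apply: piece => //; exact: YG.
Qed.

Definition envelope (Y : set (E -> R)) (a : E) : R := sup [set h a | h in Y].

Lemma envelope_has_sup (Y : set (E -> R)) a : Y !=set0 ->
  (forall h, Y h -> forall a, 0 <= h a <= 1) -> has_sup [set h a | h in Y].
Proof.
move=> [h Yh] Y01; split; first by exists (h a), h.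
by exists 1 => _ [k Yk <-]; have /andP[] := Y01 _ Yk a.
Qed.

Lemma envelope_near (Y : set (E -> R)) a (s c : R) : Y !=set0 ->
  (forall h, Y h -> forall a, 0 <= h a <= 1) ->
  (forall h, Y h -> `|h a - s| <= c) -> `|envelope Y a - s| <= c.
Proof.
move=> Yn Y01 near; have sY := envelope_has_sup a Yn Y01.
rewrite ler_distl; apply/andP; split.
  have [h Yh] := Yn; have := near _ Yh; rewrite ler_distl => /andP[+ _].
  by move=> /le_trans; apply; apply: sup_upper_bound => //; exists h.
apply: ge_sup; first by case: sY.
by move=> _ [h Yh <-]; have := near _ Yh; rewrite ler_distl => /andP[].
Qed.

Lemma envelope_uc (Y : set (E -> R)) beta e : Y !=set0 ->
  (forall h, Y h -> forall a, 0 <= h a <= 1) ->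
  (forall h, Y h -> uc_on beta e h) -> uc_on beta e (envelope Y).
Proof.
move=> Yn Y01 uc a a' aa'.
have half x y : (forall b, List.In b beta -> `|Phi x b - Phi y b| <= e) ->
    envelope Y x <= envelope Y y + 3 * e.
  move=> xy; have := envelope_has_sup x Yn Y01; case=> ne _.
  apply: ge_sup => // _ [h Yh <-].
  have /ler_normlP[_ +] := uc _ Yh _ _ xy.
  have : h y <= envelope Y y.
    by apply: sup_upper_bound; [exact: envelope_has_sup|exists h].
  by lra.
have := half _ _ aa'.
have /half : forall b, List.In b beta -> `|Phi a' b - Phi a b| <= e.
  by move=> b /aa'; rewrite distrC.
by move=> ? ?; apply/ler_normlP; split; lra.
Qed.

Lemma envelope_inv (Y : set (E -> R)) g : subflow Y -> G g ->
  envelope Y \o g = envelope Y.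
Proof.
move=> [Yn _ Y01 YG] Gg; apply/funext => a /=.
rewrite /envelope; congr sup; apply/seteqP; split => _ [h Yh <-].
  by exists (h \o g) => //; exact: YG.
have [g' Gg' gK] := Ginv Gg.
have [g'' Gg'' g'K] := Ginv Gg'.
exists (h \o g') => /=; first exact: YG.
suff -> : g' (g a) = a by [].
by rewrite -{1}(g'K a) gK g'K.
Qed.

End Pointwise.

(** * Renaming of variables and elementarity *)

Section Bounds.
Context {R : realType} {L : signature R} (M : structure L).

Lemma mdist_le1 s (x y : M s) : mdist x y <= 1.
Proof.
have := pint_dsym (fun i : 'I_2 => if i == ord0 then x else y).
by rewrite /= => <-; have /andP[] := pint_itv (dsym s)
  (fun i : 'I_2 => if i == ord0 then x else y).
Qed.

Definition apoint (V : Type) (sg : V -> lsort L) : args M sg :=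
  fun v => sval (cid (let: inhabits x := carrier_inhabited M (sg v) in
                      ex_intro (fun=> True) x I)).

Lemma eval01 (V : Type) (sg : V -> lsort L) (phi : formula sg)
  (v : args M sg) : 0 <= eval phi v <= 1.
Proof.
elim: phi v => {V sg} [V sg n ar P ts|V sg phi IH|V sg phi IH
  |V sg phi IH psi IH'|V sg s phi IH|V sg s phi IH] v /=.
- exact: pint_itv.
- by move: (IH v); lra.
- by move: (IH v); lra.
- by move: (IH v) (IH' v); case: (lerP (eval phi v - eval psi v) 0); lra.
- have [x] := carrier_inhabited M s; apply/andP; split.
    apply: le_trans (_ : eval phi (aext v x) <= _).
      by have /andP[] := IH (aext v x).
    apply: ub_le_sup; last by exists x.
    by exists 1 => _ [y _ <-]; have /andP[] := IH (aext v y).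
  apply: ge_sup; first by exists (eval phi (aext v x)), x.
  by move=> _ [y _ <-]; have /andP[] := IH (aext v y).
- have [x] := carrier_inhabited M s; apply/andP; split.
    apply: lb_le_inf; first by exists (eval phi (aext v x)), x.
    by move=> _ [y _ <-]; have /andP[] := IH (aext v y).
  apply: le_trans (_ : eval phi (aext v x) <= _); last first.
    by have /andP[] := IH (aext v x).
  apply: ge_inf; last by exists x.
  by exists 0 => _ [y _ <-]; have /andP[] := IH (aext v y).
Qed.

End Bounds.

Section Rename.
Context {R : realType} {L : signature R}.

(** The sorts of the two contexts agree only up to the equation [e], because the
    renamings of interest, such as [bindv], are defined by cases. *)
Fixpoint trename (V W : Type) (sg : V -> lsort L) (ta : W -> lsort L)
    (f : V -> W) (e : forall v, ta (f v) = sg v) s (t : term sg s) :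
    term ta s :=
  match t with
  | Var v => eq_rect _ (term ta) (Var ta (f v)) _ (e v)
  | App n ar s g ts => App g (fun i => trename e (ts i))
  end.

Definition olift (V W : Type) (f : V -> W) (o : option V) : option W :=
  if o is Some v then Some (f v) else None.

Definition olift_sort (V W : Type) (sg : V -> lsort L) (ta : W -> lsort L)
    (f : V -> W) (e : forall v, ta (f v) = sg v) s (o : option V) :
    oext ta s (olift f o) = oext sg s o :=
  match o return oext ta s (olift f o) = oext sg s o with
  | Some v => e v
  | None => erefl
  end.

Fixpoint frename (V : Type) (sg : V -> lsort L) (phi : formula sg) :
    forall (W : Type) (ta : W -> lsort L) (f : V -> W)
      (e : forall v, ta (f v) = sg v), formula ta :=
  match phi with
  | Pred n ar P ts => fun W ta f e => Pred P (fun i => trename e (ts i))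
  | Neg phi => fun W ta f e => Neg (frename phi e)
  | Half phi => fun W ta f e => Half (frename phi e)
  | Dotminus phi psi => fun W ta f e => Dotminus (frename phi e) (frename psi e)
  | Sup s phi => fun W ta f e => Sup (frename phi (olift_sort e s))
  | Inf s phi => fun W ta f e => Inf (frename phi (olift_sort e s))
  end.

Definition arename (M : structure L) (V W : Type) (sg : V -> lsort L)
    (ta : W -> lsort L) (f : V -> W) (e : forall v, ta (f v) = sg v)
    (w : args M ta) : args M sg :=
  fun v => eq_rect _ (fun s => M s : Type) (w (f v)) _ (e v).

Lemma teval_rename (M : structure L) (V W : Type) (sg : V -> lsort L)
  (ta : W -> lsort L) (f : V -> W) (e : forall v, ta (f v) = sg v)
  (w : args M ta) s (t : term sg s) :
  teval w (trename e t) = teval (arename e w) t.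
Proof.
elim: t => [v|n ar s' g ts IH] /=.
  by rewrite /arename; case: _ / (e v).
by congr fint; apply: functional_extensionality_dep => i; exact: IH.
Qed.

Lemma arename_aext (M : structure L) (V W : Type) (sg : V -> lsort L)
  (ta : W -> lsort L) (f : V -> W) (e : forall v, ta (f v) = sg v) s
  (w : args M ta) (a : M s) :
  arename (olift_sort e s) (aext w a) = aext (arename e w) a.
Proof. by apply: functional_extensionality_dep => -[]. Qed.

Lemma eval_rename (M : structure L) (V W : Type) (sg : V -> lsort L)
  (ta : W -> lsort L) (f : V -> W) (e : forall v, ta (f v) = sg v)
  (phi : formula sg) (w : args M ta) :
  eval (frename phi e) w = eval phi (arename e w).
Proof.
elim: phi W ta f e w => {V sg} [V sg n ar P ts|V sg phi IH|V sg phi IH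
  |V sg phi IH psi IH'|V sg s phi IH|V sg s phi IH] W ta f e w /=.
- congr pint; apply: functional_extensionality_dep => i.
  exact: teval_rename.
- by rewrite IH.
- by rewrite IH.
- by rewrite IH IH'.
- by congr sup; apply: eq_imagel => a _; rewrite IH arename_aext.
- by congr inf; apply: eq_imagel => a _; rewrite IH arename_aext.
Qed.

(** Quantification over a variable of the context that stays in the context,
    so that several variables can be quantified without changing the type of
    the formulae. *)
Definition bindv (V : Type) (v0 v : V) : option V :=
  if pselect (v = v0) is left _ then None else Some v.

Lemma bindv_sort (V : Type) (sg : V -> lsort L) (v0 v : V) :
  oext sg (sg v0) (bindv v0 v) = sg v.
Proof. by rewrite /bindv; case: pselect => // ->. Qed.

Definition Infv (V : Type) (sg : V -> lsort L) (v0 : V) (phi : formula sg) :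
  formula sg := Inf (frename phi (@bindv_sort V sg v0)).

Definition upd (M : structure L) (V : Type) (sg : V -> lsort L) (v0 : V)
    (w : args M sg) (a : M (sg v0)) : args M sg :=
  arename (@bindv_sort V sg v0) (aext w a).

Lemma upd_same (M : structure L) (V : Type) (sg : V -> lsort L) (v0 : V)
  (w : args M sg) (a : M (sg v0)) : upd w a v0 = a.
Proof.
rewrite /upd /arename; move: (bindv_sort sg v0 v0); rewrite /bindv.
by case: pselect => //= _ e; rewrite (Prop_irrelevance e erefl).
Qed.

Lemma upd_other (M : structure L) (V : Type) (sg : V -> lsort L) (v0 v : V)
  (w : args M sg) (a : M (sg v0)) : v <> v0 -> upd w a v = w v.
Proof.
move=> vv0; rewrite /upd /arename; move: (bindv_sort sg v0 v); rewrite /bindv.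
by case: pselect => //= _ e; rewrite (Prop_irrelevance e erefl).
Qed.

Lemma eval_Infv (M : structure L) (V : Type) (sg : V -> lsort L) (v0 : V)
  (phi : formula sg) (w : args M sg) :
  eval (Infv v0 phi) w = inf [set eval phi (upd w a) | a in [set: M (sg v0)]].
Proof. by rewrite /=; congr inf; apply: eq_imagel => a _; rewrite eval_rename. Qed.

Lemma Infv_le (M : structure L) (V : Type) (sg : V -> lsort L) (v0 : V)
  (phi : formula sg) (w : args M sg) (a : M (sg v0)) :
  eval (Infv v0 phi) w <= eval phi (upd w a).
Proof.
rewrite eval_Infv; apply: ge_inf; last by exists a.
by exists 0 => _ [y _ <-]; have /andP[] := eval01 phi (upd w y).
Qed.

Lemma Infv_lt (M : structure L) (V : Type) (sg : V -> lsort L) (v0 : V)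
  (phi : formula sg) (w : args M sg) (d : R) :
  eval (Infv v0 phi) w < d -> exists a : M (sg v0), eval phi (upd w a) < d.
Proof.
rewrite eval_Infv => lt_d.
have ne : [set eval phi (upd w a) | a in [set: M (sg v0)]] !=set0.
  by have [a] := carrier_inhabited M (sg v0); exists (eval phi (upd w a)), a.
by have [_ [a _ <-] lta] := inf_lt ne lt_d; exists a.
Qed.

(** Quantify the variables [vs] one at a time: an infimum that is below [d] in
    [P] is the same in [M], where it is nearly attained. *)
Lemma exists_elem (M P : structure L) (f : elem_emb M P) (V : Type)
  (sg : V -> lsort L) (vs : seq V) (phi : formula sg) (w : args M sg)
  (w' : args P sg) (d : R) :
  (forall v, ~ List.In v vs -> w' v = f _ (w v)) -> eval phi w' < d ->
  exists2 w2 : args M sg, forall v, ~ List.In v vs -> w2 v = w v &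
    eval phi w2 < d.
Proof.
elim: vs phi w' => [|v vs IH] phi w' ww' lt_d.
  exists w => //; rewrite -(embP f); congr (_ < d) : lt_d.
  by congr eval; apply: functional_extensionality_dep => v; rewrite ww'.
have [||w2 w2w lt2] := IH (Infv v phi) (upd w' (f _ (w v))).
- move=> u nu; have [->|uv] := pselect (u = v); first by rewrite upd_same.
  by rewrite upd_other // ww' //= => -[/esym|].
- apply: le_lt_trans lt_d; apply: le_trans (Infv_le phi _ (w' v)) _.
  rewrite le_eqVlt; apply/orP; left; apply/eqP; congr eval.
  apply: functional_extensionality_dep => u.
  have [->|uv] := pselect (u = v); first by rewrite upd_same.
  by rewrite !upd_other.
have [a lta] := Infv_lt lt2.
exists (upd w2 a) => // u nu; rewrite upd_other ?w2w//.
  by move=> uvs; apply: nu; right.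
by move=> uv; apply: nu; left.
Qed.

End Rename.

Section Connectives.
Context {R : realType} {L : signature R} {V : Type} {sg : V -> lsort L}.

Definition Avg (x y : formula sg) : formula sg :=
  Neg (Dotminus (Neg (Half x)) (Half y)).

Lemma eval_Avg (M : structure L) (x y : formula sg) (w : args M sg) :
  eval (Avg x y) w = (eval x w + eval y w) / 2.
Proof. move: (eval01 x w) (eval01 y w) => /=.
by case: (lerP (1 - eval x w / 2 - eval y w / 2) 0); lra. Qed.

Definition Maxf (x y : formula sg) : formula sg :=
  Neg (Dotminus (Neg x) (Dotminus y x)).

Lemma eval_Maxf (M : structure L) (x y : formula sg) (w : args M sg) :
  eval (Maxf x y) w = Num.max (eval x w) (eval y w).
Proof.
move: (eval01 x w) (eval01 y w) => /=.
case: (lerP (eval x w) (eval y w)); case: (lerP (eval y w - eval x w) 0) => ? ?.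
- by case: (lerP (1 - eval x w - 0) 0); lra.
- by case: (lerP (1 - eval x w - (eval y w - eval x w)) 0); lra.
- by case: (lerP (1 - eval x w - 0) 0); lra.
- by case: (lerP (1 - eval x w - (eval y w - eval x w)) 0); lra.
Qed.

(** Halving, and averaging with 1, produce all the dyadic constants. *)
Lemma constant_formula (phi : formula sg) (k : nat) (c : R) : 0 <= c <= 1 ->
  exists kappa : formula sg, forall (M : structure L) (w : args M sg),
    `|eval kappa w - c| <= 2 ^- k.
Proof.
pose zero := Dotminus phi phi.
have zeroE (M : structure L) (w : args M sg) : eval zero w = 0.
  by rewrite /= subrr maxxx.
elim: k c => [|k IH] c c01.
  exists zero => M w; rewrite zeroE expr0 invr1 ler_norml; lra.
have key (x y : R) : `|x - y| <= 2 ^- k -> `|x / 2 - y / 2| <= 2 ^- k.+1.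
  rewrite -mulrBl normrM (ger0_norm (_ : 0 <= 2^-1)) ?invr_ge0//.
  by rewrite exprSr invfM => ?; rewrite ler_pM2r.
have [c2|c2] := lerP c (1 / 2).
  have [|kappa kE] := IH (2 * c); first lra.
  exists (Half kappa) => M w; have := key _ _ (kE M w).
  by rewrite [2 * c]mulrC mulfK.
have [|kappa kE] := IH (2 * c - 1); first lra.
exists (Avg kappa (Neg zero)) => M w; have := key _ _ (kE M w).
have -> // : eval kappa w / 2 - (2 * c - 1) / 2 =
  eval (Avg kappa (Neg zero)) w - c.
rewrite eval_Avg (_ : eval (Neg zero) w = 1); first lra.
by rewrite -[LHS]/(1 - eval zero w) zeroE subr0.
Qed.

(** One formula that bounds the distances of all the formulae in [l] to
    constants approximating their values at [w']. *)
Lemma approx_formula (P : structure L) (w' : args P sg) (phi : formula sg)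
  (l : seq (formula sg)) (d : R) : 0 < d ->
  exists2 Psi : formula sg, eval Psi w' < d &
    forall (M : structure L) (w : args M sg), eval Psi w < d ->
      forall chi, List.In chi l -> `|eval chi w - eval chi w'| < 2 * d.
Proof.
move=> d0; elim: l => [|chi l [Psi Psi' PsiP]].
  by exists (Dotminus phi phi) => //=; rewrite subrr maxxx.
have [k kd] := exp2V_small d0.
have [kappa kE] := constant_formula phi k (eval01 chi w').
pose dev := Maxf (Dotminus chi kappa) (Dotminus kappa chi).
have devE (M : structure L) (w : args M sg) :
    eval dev w = `|eval chi w - eval kappa w|.
  rewrite eval_Maxf /=; have [H|H] := ger0P (eval chi w - eval kappa w).
    case: (lerP (eval chi w - eval kappa w) 0) => ?;
      case: (lerP (eval kappa w - eval chi w) 0) => ?; case: ltP => ?; lra.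
  case: (lerP (eval chi w - eval kappa w) 0) => ?;
    case: (lerP (eval kappa w - eval chi w) 0) => ?; case: ltP => ?; lra.
exists (Maxf dev Psi).
  rewrite eval_Maxf gt_max Psi' andbT devE distrC.
  exact: le_lt_trans (kE _ _) kd.
move=> M w; rewrite eval_Maxf gt_max devE => /andP[devd Psid] psi [<-|]; last first.
  exact: PsiP.
have := ler_distD (eval kappa w) (eval chi w) (eval chi w').
by have := kE M w; lra.
Qed.

End Connectives.

Section Elementarity.
Context {R : realType} {L : signature R}.

Lemma elem_approx (M P : structure L) (f : elem_emb M P) (V : Type)
  (sg : V -> lsort L) (vs : seq V) (w : args M sg) (w' : args P sg)
  (l : seq (formula sg)) (d : R) : 0 < d ->
  (forall v, ~ List.In v vs -> w' v = f _ (w v)) ->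
  exists2 w2 : args M sg, forall v, ~ List.In v vs -> w2 v = w v &
    forall chi, List.In chi l -> `|eval chi w2 - eval chi w'| < d.
Proof.
case: l => [|phi l] d0 ww'; first by exists w.
have d2 : 0 < d / 2 by lra.
have [Psi Psi' PsiP] := approx_formula w' phi (phi :: l) d2.
have [w2 w2w lt2] := exists_elem ww' Psi'.
exists w2 => // chi chil; have := PsiP _ _ lt2 _ chil.
by rewrite [2 * _]mulrC divfK.
Qed.

(** All the elements of [M] as variables: formulae with parameters in [M] turn
    into formulae in a single context, in which they can be combined. *)
Definition dsort (M : structure L) (V : Type) (sg : V -> lsort L) :
  V + {s & M s} -> lsort L := csum sg (@projT1 _ (fun s => M s)).

Definition dargs (M P : structure L) (f : forall s, M s -> P s) (V : Type)
    (sg : V -> lsort L) (a : args P sg) : args P (@dsort M V sg) :=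
  apair a (fun x => f _ (projT2 x)).

Definition dvar (M : structure L) (A : sset M) n (sg : 'I_n -> lsort L)
    (chi : pformula A sg) (i : 'I_n + 'I_(pnum chi)) : 'I_n + {s & M s} :=
  match i with
  | inl v => inl v
  | inr j => inr (existT _ (@psort _ _ _ _ _ _ chi j) (@params _ _ _ _ _ _ chi j))
  end.

Arguments dvar {M A n sg} chi i.

Lemma dvar_sort (M : structure L) (A : sset M) n (sg : 'I_n -> lsort L)
  (chi : pformula A sg) i : dsort sg (dvar chi i) = csum sg (@psort _ _ _ _ _ _ chi) i.
Proof. by case: i. Defined.

Arguments dvar_sort {M A n sg} chi i.

Definition dformula (M : structure L) (A : sset M) n (sg : 'I_n -> lsort L)
  (chi : pformula A sg) : formula (@dsort M _ sg) :=
  frename (pbody chi) (dvar_sort chi).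

Lemma peval_dformula (M P : structure L) (f : forall s, M s -> P s)
  (A : sset M) n (sg : 'I_n -> lsort L) (chi : pformula A sg) (a : args P sg) :
  peval f a chi = eval (dformula chi) (dargs f a).
Proof.
rewrite /dformula eval_rename /peval; congr eval.
by apply: functional_extensionality_dep => -[].
Qed.

(** A type realised in an elementary extension is finitely approximated in
    [M]. *)
Lemma peval_approx (M P : structure L) (f : elem_emb M P) n
  (sg : 'I_n -> lsort L) (a' : args P sg) (l : seq (pformula (sfull M) sg))
  (d : R) : 0 < d ->
  exists a : args M sg, forall chi, List.In chi l ->
    `|peval (emb_id M) a chi - peval f a' chi| < d.
Proof.
move=> d0; have [] := @elem_approx M P f _ (@dsort M _ sg)
  [seq inl v | v <- enum 'I_n] (dargs (emb_id M) (apoint M sg)) (dargs f a')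
  [seq dformula chi | chi <- l] d d0.
  move=> [v nv|x _] //; exfalso; apply: nv; apply: List.in_map.
  exact: In_enum.
move=> w2 w2w w2d; exists (fun v => w2 (inl v)) => chi chil.
have := w2d _ (List.in_map _ _ _ chil); rewrite !peval_dformula.
congr (`|eval _ _ - _| < _); apply: functional_extensionality_dep => -[//|x].
by rewrite w2w//; elim: (enum _) => //= v s IH [].
Qed.

End Elementarity.

(** * Suprema and fast Cauchy sequences *)

Section SupInf.
Context {R : realType}.

Lemma has_sup01 (A : Type) (F : A -> R) : inhabited A ->
  (forall a, 0 <= F a <= 1) -> has_sup [set F a | a in [set: A]].
Proof.
move=> [a] F01; split; first by exists (F a), a.
by exists 1 => _ [x _ <-]; have /andP[] := F01 x.
Qed.

Lemma sup_dist (A : Type) (F G : A -> R) (c : R) : inhabited A ->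
  (forall a, 0 <= F a <= 1) -> (forall a, 0 <= G a <= 1) ->
  (forall a, `|F a - G a| <= c) ->
  `|sup [set F a | a in [set: A]] - sup [set G a | a in [set: A]]| <= c.
Proof.
move=> A0; wlog suff half : F G / (forall a, 0 <= F a <= 1) ->
    (forall a, 0 <= G a <= 1) -> (forall a, `|F a - G a| <= c) ->
    sup [set F a | a in [set: A]] <= sup [set G a | a in [set: A]] + c.
  move=> F01 G01 FG; apply/ler_normlP; split.
    have := half G F G01 F01; have GF a : `|G a - F a| <= c by rewrite distrC.
    by move=> /(_ GF); lra.
  by have := half F G F01 G01 FG; lra.
move=> F01 G01 FG; apply: ge_sup; first by have [] := has_sup01 A0 F01.
move=> _ [a _ <-]; have : G a <= sup [set G a | a in [set: A]].
  by apply: sup_upper_bound; [exact: has_sup01|exists a].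
by have /ler_normlP[_] := FG a; lra.
Qed.

End SupInf.

Lemma eval_InfE (R : realType) (L : signature R) (M : structure L) (V : Type)
  (sg : V -> lsort L) s (phi : formula (oext sg s)) (v : args M sg) :
  eval (Inf phi) v = eval (Neg (Sup (Neg phi))) v.
Proof.
have A0 := carrier_inhabited M s.
have hs := has_sup01 A0 (fun a => eval01 (Neg phi) (aext v a)).
apply/eqP; rewrite eq_le; apply/andP; split => /=.
  rewrite lerBrDr -lerBrDl; apply: ge_sup; first by case: hs.
  move=> _ [a _ <-]; rewrite lerB//; apply: ge_inf; last by exists a.
  by exists 0 => _ [y _ <-]; have /andP[] := eval01 phi (aext v y).
apply: lb_le_inf; first by case: A0 => a; exists (eval phi (aext v a)), a.
move=> _ [a _ <-]; rewrite lerBlDr -lerBlDl.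
by apply: sup_upper_bound => //; exists a.
Qed.

Section Fast.
Context {R : realType}.

Lemma fast_dist (X : metricType R) (v : nat -> X) :
  (forall k, mdist (v k) (v k.+1) <= 2 ^- k) ->
  forall j k, (j <= k)%N -> mdist (v j) (v k) <= 2 * 2 ^- j.
Proof.
move=> fast j k jk; suff : mdist (v j) (v k) <= 2 * 2 ^- j - 2 * 2 ^- k.
  by have := exp2V_gt0 (R := R) k; lra.
elim: k jk => [|k IH].
  by rewrite leqn0 => /eqP ->; rewrite mdistxx subrr.
rewrite leq_eqVlt => /orP[/eqP ->|/IH le_k]; first by rewrite mdistxx subrr.
have := metric_triangle (v j) (v k) (v k.+1); have := fast k.
by rewrite exp2VS; lra.
Qed.

(** The uniform bound on the rate is what allows passing to limits index by
    index in an ultrapower. *)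
Lemma fast_limit (L : signature R) (M : structure L) s (v : nat -> M s) :
  (forall k, mdist (v k) (v k.+1) <= 2 ^- k) ->
  exists x : M s, forall k, mdist (v k) x <= 3 * 2 ^- k.
Proof.
move=> fast; have cv : cauchy (v @ \oo).
  apply/cauchy_ballP => e e0; have [k ke] : exists k, 2 ^- k < e / 4.
    by apply: exp2V_small; lra.
  exists ([set v j | j in [set j | (k <= j)%N]], [set v j | j in [set j | (k <= j)%N]]).
    by split; exists k => // j kj; exists j.
  move=> [_ _] /= [[i ki <-] [j kj <-]]; rewrite ballEmdist /=.
  have := metric_triangle (v i) (v k) (v j); rewrite (metric_sym (v i) (v k)).
  by have := fast_dist fast ki; have := fast_dist fast kj; lra.
have [x vx] := carrier_complete cv.
exists x => k; have k0 := exp2V_gt0 (R := R) k.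
have [j _ jx] := vx _ (nbhsx_ballx _ _ k0).
have := jx (maxn j k) (leq_maxl _ _); rewrite ballEmdist /= => xk.
have := fast_dist fast (leq_maxr j k).
have := metric_triangle (v k) (v (maxn j k)) x.
by rewrite (metric_sym (v (maxn j k)) x); lra.
Qed.

End Fast.

(** * Ultrapowers *)

Section Ultrapower.
Context {R : realType} {L : signature R} (N : structure L) {I : Type}.
Variables (U : set_system I) (UU : UltraFilter U).

Let PU : ProperFilter U := @ultra_proper _ _ UU.

(** In use only for functions with values in the unit interval, where the limit
    exists. *)
Definition ulim (f : I -> R) : R := lim (f @ U).

Lemma ulim_cvg (f : I -> R) : (forall i, 0 <= f i <= 1) -> f @ U --> ulim f.
Proof.
move=> f01; have [|l fl _] := @ultra_bounded_cvg R _ U UU f.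
  by apply: filterS filterT => i _; exact: f01.
by apply/cvg_ex; exists l.
Qed.

Lemma ulim_near (f : I -> R) (e : R) : (forall i, 0 <= f i <= 1) -> 0 < e ->
  U [set i | `|f i - ulim f| < e].
Proof. by move=> /ulim_cvg/cvg_distP + e0 => /(_ _ e0). Qed.

Lemma ulim_itv (f : I -> R) : (forall i, 0 <= f i <= 1) -> 0 <= ulim f <= 1.
Proof.
move=> f01; apply/andP; split.
  apply: cvg_ge_lim (ulim_cvg f01) _.
  by apply: filterS filterT => i _; have /andP[] := f01 i.
apply: cvg_le_lim (ulim_cvg f01) _.
by apply: filterS filterT => i _; have /andP[] := f01 i.
Qed.

Lemma ulim_eq (f : I -> R) (l : R) : (forall i, 0 <= f i <= 1) ->
  (forall e, 0 < e -> U [set i | `|f i - l| < e]) -> ulim f = l.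
Proof.
move=> f01 /cvg_distP fl; apply: (@cvg_unique _ _ (f @ U)) => //.
exact: ulim_cvg.
Qed.

Lemma mdist01 s (x y : N s) : 0 <= mdist x y <= 1.
Proof. by rewrite mdist_ge0 mdist_le1. Qed.

Definition ueqv s (u v : I -> N s) : Prop :=
  forall e, 0 < e -> U [set i | mdist (u i) (v i) < e].

Lemma ueqv_refl s (u : I -> N s) : ueqv u u.
Proof. by move=> e e0; apply: filterS filterT => i _ /=; rewrite mdistxx. Qed.

Lemma ueqv_sym s (u v : I -> N s) : ueqv u v -> ueqv v u.
Proof. by move=> uv e /uv; apply: filterS => i /=; rewrite metric_sym. Qed.

Lemma ueqv_trans s (v u w : I -> N s) : ueqv u v -> ueqv v w -> ueqv u w.
Proof.
move=> uv vw e e0; have e2 : 0 < e / 2 by lra.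
apply: filterS (filterI (uv _ e2) (vw _ e2)) => i [/= uvi vwi].
by have := metric_triangle (u i) (v i) (w i); lra.
Qed.

Definition upre (s : lsort L) : Type := I -> N s.
HB.instance Definition _ s := gen_eqMixin (upre s).
HB.instance Definition _ s := gen_choiceMixin (upre s).

Definition ueqvb s (u v : upre s) : bool := `[< ueqv u v >].

Lemma ueqvb_equiv s : equiv_class_of (@ueqvb s).
Proof.
split=> [u|u v|v u w]; first exact/asboolP/ueqv_refl.
  by apply/asboolP/asboolP; exact: ueqv_sym.
by move=> /asboolP uv /asboolP vw; apply/asboolP/(ueqv_trans uv).
Qed.

Canonical ueqv_rel s := EquivRelPack (ueqvb_equiv s).

Definition upow (s : lsort L) : Type := {eq_quot (ueqv_rel s)}.
HB.instance Definition _ s := Choice.on (upow s).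

Definition ucls s (u : I -> N s) : upow s := \pi_({eq_quot (ueqv_rel s)}) u.
Definition urep s (x : upow s) : I -> N s := repr (x : {eq_quot (ueqv_rel s)}).

Lemma urepK s (x : upow s) : ucls (urep x) = x.
Proof. exact: reprK. Qed.

Lemma ucls_eqP s (u v : I -> N s) : ucls u = ucls v <-> ueqv u v.
Proof.
split; first by move=> /eqmodP/asboolP.
by move=> uv; apply/eqmodP/asboolP.
Qed.

Lemma urep_cls s (u : I -> N s) : ueqv (urep (ucls u)) u.
Proof. by apply/ucls_eqP; rewrite urepK. Qed.

Definition udist s (x y : upow s) : R := ulim (fun i => mdist (urep x i) (urep y i)).

Lemma udist_near s (x y : upow s) (e : R) : 0 < e ->
  U [set i | `|mdist (urep x i) (urep y i) - udist x y| < e].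
Proof. by apply: ulim_near => i; exact: mdist01. Qed.

Lemma udistxx s (x : upow s) : udist x x = 0.
Proof.
apply: ulim_eq => [i|e e0]; first exact: mdist01.
by apply: filterS filterT => i _ /=; rewrite mdistxx subrr normr0.
Qed.

Lemma udist_positivity s (x y : upow s) : udist x y = 0 -> x = y.
Proof.
move=> xy0; rewrite -(urepK x) -(urepK y); apply/ucls_eqP => e e0.
apply: filterS (udist_near x y e0) => i /=; rewrite xy0 subr0.
by rewrite ger0_norm// mdist_ge0.
Qed.

Lemma udist_sym s (x y : upow s) : udist x y = udist y x.
Proof. by congr ulim; apply/funext => i; rewrite metric_sym. Qed.

Lemma udist_triangle s (y x z : upow s) : udist x z <= udist x y + udist y z.
Proof.
apply/ler_addgt0Pl => e e0; have e3 : 0 < e / 3 by lra.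
have [i [xz xy] yz] := filter_meet PU
  (filterI (udist_near x z e3) (udist_near x y e3)) (udist_near y z e3).
have := metric_triangle (urep x i) (urep y i) (urep z i).
by move: xz xy yz; rewrite /= !ltr_distl; lra.
Qed.

HB.instance Definition _ s := isMetric.Build R (upow s)
  (@udistxx s) (@udist_positivity s) (@udist_sym s) (@udist_triangle s).

Lemma udistE s (x y : upow s) : mdist x y = udist x y. Proof. by []. Qed.

Lemma ucls_dist s (u v : I -> N s) (e : R) : 0 < e ->
  U [set i | `|mdist (u i) (v i) - mdist (ucls u) (ucls v)| < e].
Proof.
move=> e0; have e3 : 0 < e / 3 by lra.
apply: filterS (filterI (filterI (urep_cls u e3) (urep_cls v e3))
  (udist_near (ucls u) (ucls v) e3)) => i [[/= ui vi]].
rewrite udistE !ltr_distl.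
have := metric_triangle (u i) (urep (ucls u) i) (v i).
have := metric_triangle (urep (ucls u) i) (urep (ucls v) i) (v i).
have := metric_triangle (urep (ucls u) i) (u i) (urep (ucls v) i).
have := metric_triangle (u i) (v i) (urep (ucls v) i).
rewrite (metric_sym (u i) (urep (ucls u) i)) (metric_sym (v i) (urep (ucls v) i)).
lra.
Qed.

Lemma ucls_dist_le s (u v : I -> N s) (c : R) :
  U [set i | mdist (u i) (v i) <= c] -> mdist (ucls u) (ucls v) <= c.
Proof.
move=> uvc; apply/ler_addgt0Pl => e e0.
have [i uvi /=] := filter_meet PU uvc (ucls_dist u v e0).
by rewrite ltr_distl; move: uvi => /=; lra.
Qed.

Lemma ucls_dist_lt s (u v : I -> N s) (c : R) :
  mdist (ucls u) (ucls v) < c -> U [set i | mdist (u i) (v i) < c].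
Proof.
move=> uvc; have e0 : 0 < c - mdist (ucls u) (ucls v) by lra.
by apply: filterS (ucls_dist u v e0) => i /=; rewrite ltr_distl; lra.
Qed.

(** A fast Cauchy sequence of classes has representatives that are fast Cauchy
    at every index: stop following the given representatives at the first jump
    that is too large. *)
Lemma upow_fast_complete s (x : nat -> upow s) :
  (forall k, mdist (x k) (x k.+1) < 2 ^- k) ->
  exists l : upow s, forall k, mdist (x k) l <= 3 * 2 ^- k.
Proof.
move=> fast; pose r k := urep (x k).
pose v := fix v k i := if k is k'.+1 then
  if mdist (v k' i) (r k i) < 2 ^- k' then r k i else v k' i else r 0%N i.
have /choice[l lP] i : exists l : N s, forall k, mdist (v k i) l <= 3 * 2 ^- k.
  apply: (@fast_limit R L N s (v ^~ i)) => k /=.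
  case: ifP => [/ltW //|_]; rewrite mdistxx; exact/ltW/exp2V_gt0.
have vr k : U [set i | v k i = r k i].
  elim: k => [|k IH]; first by apply: filterS filterT.
  have : U [set i | mdist (r k i) (r k.+1 i) < 2 ^- k].
    by apply: ucls_dist_lt; rewrite !urepK.
  move=> /(filterI IH); apply: filterS => i [/= -> ->] //.
exists (ucls l) => k; rewrite -[x k]urepK; apply: ucls_dist_le.
by apply: filterS (vr k) => i /=; rewrite -/(r k) => <-; exact: lP.
Qed.

(** [K] picks a fast subsequence; adding the indices up makes it monotone. *)
Lemma upow_complete s (u : nat -> upow s) :
  cauchy (u @ \oo) -> exists l : upow s, u @ \oo --> l.
Proof.
move=> /cauchy_ballP cu.
have /choice[k0 k0P] j : exists k, forall m n, (k <= m)%N -> (k <= n)%N ->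
    mdist (u m) (u n) < 2 ^- j.
  have [[/= A B] [/= [a _ aA] [b _ bB]] AB] := cu _ (exp2V_gt0 j).
  exists (maxn a b) => m n; rewrite !geq_max => /andP[am _] /andP[_ bn].
  have := AB (u m, u n); rewrite /= ballEmdist; apply.
  by split; [exact: aA|exact: bB].
pose K j := (\sum_(i < j.+1) k0 i)%N.
have k0K j : (k0 j <= K j)%N by rewrite /K big_ord_recr /= leq_addl.
have KS j : (K j <= K j.+1)%N by rewrite [K j.+1]/K big_ord_recr /= leq_addr.
have [|l lP] := @upow_fast_complete s (u \o K).
  by move=> j; apply: k0P => //; exact: leq_trans (KS j).
exists l; apply/cvg_ballP => e e0.
have [j je] : exists j, 2 ^- j < e / 4 by apply: exp2V_small; lra.
exists (K j) => // m Km; rewrite ballEmdist /=.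
have := k0P j _ _ (k0K j) (leq_trans (k0K j) Km).
have := lP j; have := metric_triangle l (u (K j)) (u m).
by rewrite (metric_sym l (u (K j))) /=; lra.
Qed.

(** [Q] stands for a statement of uniform continuity: the moduli concern one
    argument each, and the arguments are changed one at a time. *)
Lemma one_by_one n (ar : 'I_n -> lsort L)
  (Q : (forall j, I -> N (ar j)) -> (forall j, I -> N (ar j)) -> Prop) :
  (forall a, Q a a) -> (forall a b c, Q a b -> Q b c -> Q a c) ->
  (forall a b j, (forall k, k != j -> a k = b k) -> ueqv (a j) (b j) -> Q a b) ->
  forall a b, (forall j, ueqv (a j) (b j)) -> Q a b.
Proof.
move=> Qr Qt Q1 a b ab.
pose hyb k (j : 'I_n) := if (j < k)%N then b j else a j.
have Qh k : (k <= n)%N -> Q a (hyb k).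
  elim: k => [|k IH] kn.
    by rewrite (_ : hyb 0%N = a).
  apply: (Qt _ _ _ (IH (ltnW kn))); apply: (Q1 _ _ (Ordinal kn)).
    move=> j jk; rewrite /hyb [(j < k.+1)%N]ltnS [(j <= k)%N]leq_eqVlt.
    have [jk'|//] := eqVneq (j : nat) k.
    by exfalso; move/eqP: jk; apply; exact: val_inj.
  have -> : hyb k (Ordinal kn) = a (Ordinal kn).
    by rewrite /hyb ifF// [X in (X < k)%N]/= ltnn.
  have -> : hyb k.+1 (Ordinal kn) = b (Ordinal kn).
    by rewrite /hyb ifT// [X in (X < k.+1)%N]/= ltnSn.
  exact: ab.
have <- : hyb n = b.
  by apply: functional_extensionality_dep => j; rewrite /hyb ltn_ord.
exact: Qh.
Qed.

Lemma ueqv_fint n (ar : 'I_n -> lsort L) s (g : fsym ar s)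
  (a b : forall j, I -> N (ar j)) : (forall j, ueqv (a j) (b j)) ->
  ueqv (fun i => fint g (fun j => a j i)) (fun i => fint g (fun j => b j i)).
Proof.
apply: (@one_by_one n ar (fun a b => ueqv (fun i => fint g (fun j => a j i))
  (fun i => fint g (fun j => b j i)))); first by move=> c; exact: ueqv_refl.
  by move=> c d e; exact: ueqv_trans.
move=> c d j cd cdj e e0; have e2 : 0 < e / 2 by lra.
apply: filterS (cdj _ (modfun_gt0 (fmod g j) e2)) => i /= cdi.
apply: le_lt_trans (_ : e / 2 < e); last lra.
by apply: (fint_mod (i := j)) => // k kj; rewrite cd.
Qed.

Lemma ueqv_pint n (ar : 'I_n -> lsort L) (P : psym ar)
  (a b : forall j, I -> N (ar j)) : (forall j, ueqv (a j) (b j)) ->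
  forall e, 0 < e -> U [set i | `|pint P (fun j => a j i) -
    pint P (fun j => b j i)| < e].
Proof.
apply: (@one_by_one n ar (fun a b => forall e, 0 < e ->
  U [set i | `|pint P (fun j => a j i) - pint P (fun j => b j i)| < e])).
- by move=> c e e0; apply: filterS filterT => i _; rewrite /= subrr normr0.
- move=> c d d' cd dd' e e0; have e2 : 0 < e / 2 by lra.
  apply: filterS (filterI (cd _ e2) (dd' _ e2)) => i [/= h1 h2].
  have := ler_distD (pint P (fun j => d j i)) (pint P (fun j => c j i))
    (pint P (fun j => d' j i)); lra.
move=> c d j cd cdj e e0; have e2 : 0 < e / 2 by lra.
apply: filterS (cdj _ (modfun_gt0 (pmod P j) e2)) => i /= cdi.
apply: le_lt_trans (_ : e / 2 < e); last lra.
by apply: (pint_mod (i := j)) => // k kj; rewrite cd.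
Qed.

Definition ufint n (ar : 'I_n -> lsort L) s (g : fsym ar s)
  (v : forall j, upow (ar j)) : upow s :=
  ucls (fun i => fint g (fun j => urep (v j) i)).

Definition upint n (ar : 'I_n -> lsort L) (P : psym ar)
  (v : forall j, upow (ar j)) : R :=
  ulim (fun i => pint P (fun j => urep (v j) i)).

Lemma upow_inhabited s : inhabited (upow s).
Proof. by have [x] := carrier_inhabited N s; exists; exact: ucls (fun=> x). Qed.

Lemma upint_itv n (ar : 'I_n -> lsort L) (P : psym ar) v : 0 <= upint P v <= 1.
Proof. by apply: ulim_itv => i; exact: pint_itv. Qed.

Lemma upint_dsym s (v : 'I_2 -> upow s) :
  upint (dsym s) v = mdist (v ord0) (v ord_max).
Proof. by congr ulim; apply/funext => i; rewrite pint_dsym. Qed.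

Lemma ufint_mod n (ar : 'I_n -> lsort L) s (g : fsym ar s) (i : 'I_n)
  (u v : forall i, upow (ar i)) (e : R) :
  (forall j, j != i -> u j = v j) -> 0 < e ->
  mdist (u i) (v i) < fmod g i e -> mdist (ufint g u) (ufint g v) <= e.
Proof.
move=> uv e0; rewrite -[u i]urepK -[v i]urepK => /ucls_dist_lt uvi.
apply: ucls_dist_le; apply: filterS uvi => k /= uvk.
by apply: (fint_mod (i := i)) => // j /uv ->.
Qed.

Lemma upint_mod n (ar : 'I_n -> lsort L) (P : psym ar) (i : 'I_n)
  (u v : forall i, upow (ar i)) (e : R) :
  (forall j, j != i -> u j = v j) -> 0 < e ->
  mdist (u i) (v i) < pmod P i e -> `|upint P u - upint P v| <= e.
Proof.
move=> uv e0; rewrite -[u i]urepK -[v i]urepK => /ucls_dist_lt uvi.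
apply/ler_addgt0Pl => d d0; have d2 : 0 < d / 2 by lra.
have near w := @ulim_near (fun k => pint P (fun j => urep (w j) k)) _
  (fun k => pint_itv P _) d2.
have [k [/= uvk uk] vk] := filter_meet PU (filterI uvi (near u)) (near v).
have : `|pint P (fun j => urep (u j) k) - pint P (fun j => urep (v j) k)| <= e.
  by apply: (pint_mod (i := i)) => // j /uv ->.
move: uk vk; rewrite /= -/(upint P u) -/(upint P v) !ltr_distl !ler_distl; lra.
Qed.

Definition ultrapower : structure L :=
  @Structure R L (fun s => upow s : metricType R) ufint upint upow_inhabited
    upow_complete upint_itv upint_dsym ufint_mod upint_mod.

End Ultrapower.

(** * The theorem of Los and limits of types *)

Section Los.
Context {R : realType} {L : signature R} (N : structure L) {I : Type}.
Variables (U : set_system I) (UU : UltraFilter U).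

Let PU : ProperFilter U := @ultra_proper _ _ UU.
Local Notation P := (ultrapower N UU).

Definition eqv_args (V : Type) (sg : V -> lsort L) (u v : I -> args N sg) :=
  forall x, ueqv U (fun i => u i x) (fun i => v i x).

Lemma teval_eqv (V : Type) (sg : V -> lsort L) s (t : term sg s)
  (u v : I -> args N sg) : eqv_args u v ->
  ueqv U (fun i => teval (u i) t) (fun i => teval (v i) t).
Proof.
move=> uv; elim: t => [x|n ar s' g ts IH] /=; first exact: uv.
exact: (ueqv_fint UU g (a := fun j i => teval (u i) (ts j))
  (b := fun j i => teval (v i) (ts j))).
Qed.

Lemma eqv_args_aext (V : Type) (sg : V -> lsort L) s (u v : I -> args N sg)
  (a b : I -> N s) : eqv_args u v -> ueqv U a b ->
  eqv_args (fun i => aext (u i) (a i)) (fun i => aext (v i) (b i)).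
Proof. by move=> uv ab [x|]; [exact: uv|exact: ab]. Qed.

Definition eval_eqv_at (V : Type) (sg : V -> lsort L) (phi : formula sg) :=
  forall u v : I -> args N sg, eqv_args u v -> forall e, 0 < e ->
    U [set i | `|eval phi (u i) - eval phi (v i)| < e].

Lemma eval_eqv_Neg (V : Type) (sg : V -> lsort L) (phi : formula sg) :
  eval_eqv_at phi -> eval_eqv_at (Neg phi).
Proof.
move=> IH u v uv e e0; apply: filterS (IH _ _ uv e e0) => i /=.
by rewrite !ltr_distl; lra.
Qed.

(** No uniform modulus is needed to go under a quantifier: pick at every index
    a witness of a large variation, if there is one. *)
Lemma eval_eqv_Sup (V : Type) (sg : V -> lsort L) s (phi : formula (oext sg s)) :
  eval_eqv_at phi -> eval_eqv_at (Sup phi).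
Proof.
move=> IH u v uv e e0; have e2 : 0 < e / 2 by lra.
pose far i a := e / 2 <= `|eval phi (aext (u i) a) - eval phi (aext (v i) a)|.
have /choice[a aP] i : exists a : N s, (exists b, far i b) -> far i a.
  have [[b fb]|nb] := pselect (exists b, far i b); first by exists b.
  by have [x] := carrier_inhabited N s; exists x.
apply: filterS (IH _ _ (eqv_args_aext uv (ueqv_refl UU a)) _ e2) => i /= ai.
apply: le_lt_trans (_ : e / 2 < e); last lra.
apply: sup_dist; [exact: carrier_inhabited|by move=> b; exact: eval01
  |by move=> b; exact: eval01|] => b.
rewrite leNgt; apply/negP => /ltW fb.
by have := aP i (ex_intro _ b fb); rewrite /far leNgt ai.
Qed.

Lemma eval_eqv (V : Type) (sg : V -> lsort L) (phi : formula sg) :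
  eval_eqv_at phi.
Proof.
elim: phi => {V sg} [V sg n ar Q ts|V sg phi IH|V sg phi IH
  |V sg phi IH psi IH'|V sg s phi IH|V sg s phi IH].
- move=> u v uv e e0 /=.
  apply: (ueqv_pint UU Q (a := fun j i => teval (u i) (ts j))
    (b := fun j i => teval (v i) (ts j))) e0 => j.
  exact: teval_eqv.
- exact: eval_eqv_Neg.
- move=> u v uv e e0; apply: filterS (IH _ _ uv e e0) => i /=.
  by rewrite !ltr_distl; lra.
- move=> u v uv e e0; have e2 : 0 < e / 2 by lra.
  apply: filterS (filterI (IH _ _ uv _ e2) (IH' _ _ uv _ e2)) => i [] /=.
  rewrite !ltr_distl.
  case: (lerP (eval phi (u i) - eval psi (u i)) 0) => ?;
    case: (lerP (eval phi (v i) - eval psi (v i)) 0) => ? *; lra.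
- exact: eval_eqv_Sup.
- move=> u v uv e e0.
  have := eval_eqv_Neg (eval_eqv_Sup (eval_eqv_Neg IH)) uv e0.
  by apply: filterS => i; rewrite /mkset !eval_InfE.
Qed.

Definition arep (V : Type) (sg : V -> lsort L) (v : args P sg) (i : I) :
  args N sg := fun x => urep (v x) i.

Lemma teval_ultrapower (V : Type) (sg : V -> lsort L) s (t : term sg s)
  (v : args P sg) : teval v t = ucls UU (fun i => teval (arep v i) t).
Proof.
elim: t => [x|n ar s' g ts IH] /=; first by rewrite [RHS]urepK.
apply/ucls_eqP.
apply: (ueqv_fint UU g (a := fun j i => urep (teval v (ts j)) i)
  (b := fun j i => teval (arep v i) (ts j))) => j.
by rewrite IH; exact: urep_cls.
Qed.

Definition los_at (V : Type) (sg : V -> lsort L) (phi : formula sg) :=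
  forall (v : args P sg) e, 0 < e ->
    U [set i | `|eval phi (arep v i) - eval phi v| < e].

Lemma los_Neg (V : Type) (sg : V -> lsort L) (phi : formula sg) :
  los_at phi -> los_at (Neg phi).
Proof.
move=> IH v e e0; apply: filterS (IH v e e0) => i /=.
by rewrite !ltr_distl; lra.
Qed.

(** The class [a] nearly attains the supremum in the ultrapower, and the class
    [b] of the near-witnesses [w] nearly attains the limit of the suprema. *)
Lemma los_Sup (V : Type) (sg : V -> lsort L) s (phi : formula (oext sg s)) :
  los_at phi -> los_at (Sup phi).
Proof.
move=> IH v e e0; have e4 : 0 < e / 4 by lra.
have hasP := has_sup01 (carrier_inhabited P s)
  (fun a => eval01 phi (aext v a)).
have hasN i := has_sup01 (carrier_inhabited N s)
  (fun a => eval01 phi (aext (arep v i) a)).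
have [_ [a _ <-] a_max] := sup_adherent e4 hasP.
have /choice[w wP] i : exists b : N s, eval (Sup phi) (arep v i) - e / 4 <
    eval phi (aext (arep v i) b).
  by have [_ [b _ <-] ?] := sup_adherent e4 (hasN i); exists b.
pose b : P s := ucls UU w.
have arepE (c : P s) i : arep (aext v c) i = aext (arep v i) (urep c i).
  by apply: functional_extensionality_dep => -[].
have wb : eqv_args (fun i => aext (arep v i) (w i)) (arep (aext v b)).
  have : eqv_args (fun i => aext (arep v i) (w i))
      (fun i => aext (arep v i) (urep b i)).
    apply: eqv_args_aext; first by move=> x; exact: ueqv_refl.
    by apply: ueqv_sym; exact: urep_cls.
  by congr eqv_args; apply/funext => i; rewrite arepE.
apply: filterS (filterI (IH (aext v a) _ e4) (filterI (IH (aext v b) _ e4)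
  (eval_eqv phi wb e4))) => i [/= ai [bi wi]].
have leP : eval phi (aext v b) <= eval (Sup phi) v.
  by apply: sup_upper_bound => //; exists b.
have leN : eval phi (arep (aext v a) i) <= eval (Sup phi) (arep v i).
  by rewrite arepE; apply: sup_upper_bound => //; exists (urep a i).
have wi' := wP i; rewrite -!/(eval (Sup phi) _) in a_max leP leN wi' *.
move: ai bi wi; rewrite !ltr_distl; move: a_max leP leN wi' => /=; lra.
Qed.

Lemma los (V : Type) (sg : V -> lsort L) (phi : formula sg) : los_at phi.
Proof.
elim: phi => {V sg} [V sg n ar Q ts|V sg phi IH|V sg phi IH
  |V sg phi IH psi IH'|V sg s phi IH|V sg s phi IH].
- move=> v e e0 /=; have e2 : 0 < e / 2 by lra.
  have near : U [set i | `|pint Q (fun j => urep (teval v (ts j)) i) -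
      eval (Pred Q ts) v| < e / 2].
    by apply: ulim_near => // i; exact: pint_itv.
  have same j : ueqv U (fun i => teval (arep v i) (ts j))
      (urep (teval v (ts j))).
    by rewrite teval_ultrapower; apply: ueqv_sym; exact: urep_cls.
  have := ueqv_pint UU Q (a := fun j i => teval (arep v i) (ts j))
    (b := fun j i => urep (teval v (ts j)) i) same e2.
  move=> /(filterI near); apply: filterS => i [/= ni si].
  have := ler_distD (pint Q (fun j => urep (teval v (ts j)) i))
    (pint Q (fun j => teval (arep v i) (ts j))) (eval (Pred Q ts) v).
  by move: ni si => /=; lra.
- exact: los_Neg.
- move=> v e e0; apply: filterS (IH v e e0) => i /=.
  by rewrite !ltr_distl; lra.
- move=> v e e0; have e2 : 0 < e / 2 by lra.
  apply: filterS (filterI (IH v _ e2) (IH' v _ e2)) => i [] /=.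
  rewrite !ltr_distl.
  case: (lerP (eval phi (arep v i) - eval psi (arep v i)) 0) => ?;
    case: (lerP (eval phi v - eval psi v) 0) => ? *; lra.
- exact: los_Sup.
- move=> v e e0; have := los_Neg (los_Sup (los_Neg IH)) v e0.
  by apply: filterS => i; rewrite /mkset !eval_InfE.
Qed.

Lemma los_cvg (V : Type) (sg : V -> lsort L) (phi : formula sg)
  (u : I -> args N sg) :
  eval phi (u i) @[i --> U] --> eval phi ((fun x => ucls UU (u ^~ x)) : args P sg).
Proof.
set v : args P sg := fun x => _.
apply/cvg_distP => e e0; have e2 : 0 < e / 2 by lra.
have uv : eqv_args u (arep v).
  by move=> x; apply: ueqv_sym; exact: urep_cls.
apply: filterS (filterI (eval_eqv phi uv e2) (los phi v e2)) => i [/= ui vi].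
have := ler_distD (eval phi (arep v i)) (eval phi (u i)) (eval phi v); lra.
Qed.

Arguments los_cvg {V sg} phi u.

Definition diag s (x : N s) : P s := ucls UU (fun=> x).

Lemma diagP (V : Type) (sg : V -> lsort L) (phi : formula sg) (v : args N sg) :
  eval phi (amap diag v) = eval phi v.
Proof.
by apply: (cvg_unique _ (los_cvg phi (fun=> v))); [exact: Rhausdorff|exact: cvg_cst].
Qed.

Definition diag_emb : elem_emb N P := ElemEmb diagP.

(** The limit along an ultrafilter of the types of the members of a family of
    tuples is again a type: this is the compactness of type spaces. *)
Lemma ultralimit_type n (sg : 'I_n -> lsort L) (u : I -> args N sg) :
  exists q : ctype sg (sfull N), forall chi,
    peval (emb_id N) (u i) chi @[i --> U] --> q chi.
Proof.
pose a : args P sg := fun x => ucls UU (u ^~ x).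
have real : exists (Q : structure L) (f : elem_emb N Q) (b : args Q sg),
    forall psi : pformula (sfull N) sg, peval diag_emb a psi = peval f b psi.
  by exists P, diag_emb, a.
exists (CType real) => chi /=.
rewrite /peval (_ : apair a _ = fun x =>
  ucls UU ((fun i => apair (u i) (@params _ _ _ _ _ _ chi)) ^~ x)).
  exact: los_cvg.
by apply: functional_extensionality_dep => -[].
Qed.

End Los.

(** * Small cardinals *)

Section Small.

Lemma card_leTP (K X : Type) :
  [set: K] #<= [set: X] <-> exists f : K -> X, injective f.
Proof.
split=> [/card_leP[f]|[f f_inj]].
  exists (fun k => sval (f (exist _ k (mem_set I)))) => x y /val_inj fxy.
  by have [] := inj (in_setT _) (in_setT _) fxy.
rewrite -(card_le_eql (inj_card_eq (A := [set: K]) (f := f) _)).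
  exact: card_leT.
by move=> x y _ _; exact: f_inj.
Qed.

Lemma small_inj (K X Y : Type) (f : X -> Y) : injective f ->
  small K Y -> small K X.
Proof. by move=> fi sY KX; apply: sY; apply: card_le_trans KX _; apply/card_leTP; exists f. Qed.

(** Hilbert's hotel: an infinite cardinal absorbs one more point. *)
Lemma small_option (K X : Type) : [set: nat] #<= [set: K] ->
  small K X -> small K (option X).
Proof.
move=> /card_leTP[e e_inj] sX /card_leTP[f f_inj]; apply: sX.
have [/existsNP/= [x0 /contrapT fx0]|fN] := pselect (~ forall x, f x <> None);
  last first.
  have /choice[g gE] : forall x, exists y, f x = Some y.
    by move=> x; move/contrapT: fN => /(_ x); case: (f x) => // y _; exists y.
  by apply/card_leTP; exists g => x y gxy; apply: f_inj; rewrite !gE gxy.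
(* [shift] is injective and misses [e 0]; [swap] exchanges [e 0] and [x0]. *)
pose shift x := if pselect (exists k, x = e k) is left h
  then e (sval (cid h)).+1 else x.
have shift_e k : shift (e k) = e k.+1.
  rewrite /shift; case: pselect => [h|[]]; last by exists k.
  by case: cid => j /= /e_inj ->.
have shift_o x : ~ (exists k, x = e k) -> shift x = x.
  by rewrite /shift; case: pselect.
have shift0 x : shift x <> e 0%N.
  have [[k ->]|nx] := pselect (exists k, x = e k).
    by rewrite shift_e => /e_inj.
  by rewrite shift_o// => xe; apply: nx; exists 0%N.
have shift_inj : injective shift.
  move=> x y; have [[k ->]|nx] := pselect (exists k, x = e k);
    have [[j ->]|ny] := pselect (exists k, y = e k).
  - by rewrite !shift_e => /e_inj [->].
  - by rewrite shift_e shift_o// => ye; exfalso; apply: ny; exists k.+1.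
  - by rewrite shift_e shift_o// => xe; exfalso; apply: nx; exists j.+1.
  - by rewrite !shift_o.
pose swap x := if pselect (x = e 0%N) then x0
  else if pselect (x = x0) then e 0%N else x.
have swap_e : swap (e 0%N) = x0 by rewrite /swap; case: pselect.
have swap_inj : injective swap.
  have swap_x0 : swap x0 = e 0%N.
    by rewrite /swap; case: pselect => // ?; case: pselect.
  have swap_o y : y <> e 0%N -> y <> x0 -> swap y = y.
    by move=> *; rewrite /swap; case: pselect => // ?; case: pselect.
  apply: (@can_inj _ _ _ swap) => x.
  have [->|xe] := pselect (x = e 0%N); first by rewrite swap_e.
  have [->|xx0] := pselect (x = x0); first by rewrite swap_x0.
  by rewrite !swap_o.
have swap0 x : x <> e 0%N -> f (swap x) <> None.
  by move=> xe; rewrite -fx0 -swap_e => /f_inj/swap_inj.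
have /choice[g gE] : forall x, exists y, f (swap (shift x)) = Some y.
  move=> x; have := swap0 _ (@shift0 x).
  by case: (f _) => // y _; exists y.
apply/card_leTP; exists g => x y gxy; apply: shift_inj; apply: swap_inj.
by apply: f_inj; rewrite !gE gxy.
Qed.

Lemma small_add_list (K T : Type) (Q : T -> Prop) (l : seq T) :
  [set: nat] #<= [set: K] -> small K {x | Q x} ->
  small K {x | Q x \/ List.In x l}.
Proof.
move=> Kinf sQ; elim: l => [|z l IH].
  pose f (x : {x | Q x \/ List.In x [::]}) : {x | Q x} :=
    exist Q (sval x) (match svalP x with or_introl q => q
      | or_intror bot => match bot with end end).
  apply: (small_inj (f := f)) sQ => -[x qx] [y qy] [xy].
  exact: eq_exist.
pose f (x : {x | Q x \/ List.In x (z :: l)}) :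
    option {x | Q x \/ List.In x l} :=
  if pselect (Q (sval x) \/ List.In (sval x) l) is left h
  then Some (exist _ (sval x) h) else None.
apply: (small_inj (f := f)); last exact: small_option.
move=> [x hx] [y hy]; rewrite /f /=; case: pselect => xl; case: pselect => yl //.
  by move=> [xy]; exact: eq_exist.
move=> _; apply: eq_exist.
have is_z u : Q u \/ List.In u (z :: l) -> ~ (Q u \/ List.In u l) -> u = z.
  by move=> [q|[->|ul]] nu //; exfalso; apply: nu; [left|right].
by rewrite (is_z x)// (is_z y).
Qed.

Lemma small_ord_sum (K X : Type) n : [set: nat] #<= [set: K] ->
  small K X -> small K ('I_n + X).
Proof.
move=> Kinf sX.
pose Q (x : 'I_n + X) := if x is inr _ then True else False.
have sQ : small K {x | Q x}.
  pose f (x : {x | Q x}) : X := match x with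
    | exist (inr y) _ => y | exist (inl v) h => match h with end end.
  apply: (small_inj (f := f)) sX => -[[//|x] qx] [[//|y] qy] /= ->.
  exact: eq_exist.
have cover (x : 'I_n + X) : Q x \/ List.In x [seq inl v | v <- enum 'I_n].
  by case: x => [v|x]; [right; apply: List.in_map; exact: In_enum|left].
apply: (small_inj (f := fun x => exist _ x (cover x))).
  by move=> x y [].
exact: small_add_list.
Qed.

End Small.

Section Infinite.
Context {R : realType} {L : signature R}.

Fixpoint neg_depth (V : Type) (sg : V -> lsort L) (phi : formula sg) : nat :=
  if phi is Neg psi then (neg_depth psi).+1 else 0.

(** Iterated negations already give infinitely many formulae. *)
Lemma small_formulae_infinite (K : Type) (s : lsort L) :
  small K (@all_formulae R L) -> [set: nat] #<= [set: K].
Proof.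
move=> sK; apply/infiniteP => /finite_setP[k Kk]; apply: sK.
rewrite (card_le_eql Kk); apply: card_le_trans (card_leT _) _.
pose sg := fun _ : 'I_2 => s.
pose phi : formula sg := Pred (dsym s) (fun i => Var sg i).
apply/card_leTP.
exists (fun k => existT _ 2%N (existT _ sg (iter k (@Neg R L _ sg) phi))) => i j.
move=> /(congr1 (fun x : all_formulae => neg_depth (projT2 (projT2 x)))) /=.
have dE k' : neg_depth (iter k' (@Neg R L _ sg) phi) = k'.
  by elim: k' => //= k' ->.
by rewrite !dE.
Qed.

End Infinite.

(** * Types over a model and finitely many parameters *)

Lemma dependent_choice_fun (T : Type) (S : T -> Type)
  (P : forall x, S x -> Prop) : (forall x, exists y, P x y) ->
  exists f : forall x, S x, forall x, P x (f x).
Proof. by move=> H; exists (fun x => sval (cid (H x))) => x; case: cid. Qed.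

Section FiniteSupport.
Context {R : realType} {L : signature R}.

Definition sub_sort (V : Type) (sg : V -> lsort L) (S : V -> Prop)
  (x : {v | S v}) : lsort L := sg (sval x).

Arguments sub_sort {V} sg S x.

Definition sub_args (M : structure L) (V : Type) (sg : V -> lsort L)
  (S : V -> Prop) (w : args M sg) : args M (sub_sort sg S) :=
  fun x => w (sval x).

Arguments sub_args {M V sg} S w.

Lemma term_support (V : Type) (sg : V -> lsort L) s (t : term sg s) :
  exists l : seq V, forall S : V -> Prop, (forall v, List.In v l -> S v) ->
    exists t' : term (sub_sort sg S) s,
      forall (M : structure L) (w : args M sg),
        teval w t = teval (sub_args S w) t'.
Proof.
elim: t => [v|n ar s' g ts /choice[l lP]].
  exists [:: v] => S Sl.
  by exists (Var (sub_sort sg S) (exist S v (Sl v (or_introl erefl)))).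
exists (flatten [seq l i | i <- enum 'I_n]) => S Sl.
have /dependent_choice_fun[t' t'P] i : exists t' : term (sub_sort sg S) (ar i),
    forall (M : structure L) (w : args M sg),
      teval w (ts i) = teval (sub_args S w) t'.
  apply: lP => v vl; apply: Sl.
  exact: In_flatten (In_enum i) vl.
exists (App g t') => M w /=; congr fint.
by apply: functional_extensionality_dep => i; exact: t'P.
Qed.

Definition osub (V : Type) (S : V -> Prop) (o : option V) : Prop :=
  if o is Some v then S v else True.

Definition osub_var (V : Type) (S : V -> Prop) (x : {o | osub S o}) :
    option {v | S v} :=
  match x with
  | exist (Some v) Sv => Some (exist S v Sv)
  | exist None _ => None
  end.

Lemma osub_sort (V : Type) (sg : V -> lsort L) (S : V -> Prop) s
  (x : {o | osub S o}) :
  oext (sub_sort sg S) s (osub_var x) =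
  sub_sort (oext sg s) (osub S) x.
Proof. by case: x => -[]. Defined.

Lemma osub_in (V : Type) (S : V -> Prop) (l : seq (option V)) :
  (forall v, List.In v (pmap id l) -> S v) ->
  forall o, List.In o l -> osub S o.
Proof.
elim: l => //= -[v|] l IH Sl o [<-//=|ol].
- by apply: Sl; left.
- by apply: IH => // u ul; apply: Sl; right.
- by apply: IH.
Qed.

Lemma sub_args_aext (M : structure L) (V : Type) (sg : V -> lsort L)
  (S : V -> Prop) s (w : args M sg) (a : M s) :
  arename (@osub_sort V sg S s) (aext (sub_args S w) a) =
  sub_args (osub S) (aext w a).
Proof. by apply: functional_extensionality_dep => -[[]]. Qed.

(** [S] ranges over all the predicates that hold on the finite list [l], so that
    the supports of the subformulae can be enlarged to a common one. *)
Lemma formula_support (V : Type) (sg : V -> lsort L) (phi : formula sg) :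
  exists l : seq V, forall S : V -> Prop, (forall v, List.In v l -> S v) ->
    exists phi' : formula (sub_sort sg S),
      forall (M : structure L) (w : args M sg),
        eval phi w = eval phi' (sub_args S w).
Proof.
elim: phi => {V sg} [V sg n ar Q ts|V sg phi IH|V sg phi IH
  |V sg phi IH psi IH'|V sg s phi IH|V sg s phi IH].
- have /choice[l lP] i := term_support (ts i).
  exists (flatten [seq l i | i <- enum 'I_n]) => S Sl.
  have /dependent_choice_fun[t' t'P] i : exists t' : term (sub_sort sg S) (ar i),
      forall (M : structure L) (w : args M sg),
        teval w (ts i) = teval (sub_args S w) t'.
    apply: lP => v vl; apply: Sl.
    exact: In_flatten (In_enum i) vl.
  exists (Pred Q t') => M w /=; congr pint.
  by apply: functional_extensionality_dep => i; exact: t'P.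
- have [l lP] := IH; exists l => S /lP[phi' E].
  by exists (Neg phi') => M w /=; rewrite E.
- have [l lP] := IH; exists l => S /lP[phi' E].
  by exists (Half phi') => M w /=; rewrite E.
- have [l lP] := IH; have [l' l'P] := IH'; exists (l ++ l') => S Sl.
  have [|phi' E] := lP S.
    by move=> v vl; apply: Sl; apply/List.in_or_app; left.
  have [|psi' E'] := l'P S.
    by move=> v vl; apply: Sl; apply/List.in_or_app; right.
  by exists (Dotminus phi' psi') => M w /=; rewrite E E'.
- have [l lP] := IH; exists (pmap id l) => S /osub_in/lP[phi' E].
  exists (Sup (frename phi' (@osub_sort V sg S s))) => M w /=.
  by congr sup; apply: eq_imagel => a _; rewrite E eval_rename sub_args_aext.
- have [l lP] := IH; exists (pmap id l) => S /osub_in/lP[phi' E].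
  exists (Inf (frename phi' (@osub_sort V sg S s))) => M w /=.
  by congr inf; apply: eq_imagel => a _; rewrite E eval_rename sub_args_aext.
Qed.

(** A formula in the variables [sg] and all the elements of [M] mentions only
    finitely many of the latter, and these can serve as parameters. *)
Lemma dformula_pformula (M : structure L) n (sg : 'I_n -> lsort L)
  (chi : formula (@dsort R L M _ sg)) :
  exists chi' : pformula (sfull M) sg,
    forall (P : structure L) (f : forall s, M s -> P s) (a : args P sg),
      eval chi (dargs f a) = peval f a chi'.
Proof.
have [l lP] := formula_support chi.
pose isM (v : 'I_n + {s & M s}) := if v is inr x then Some x else None.
pose lM := pmap isM l.
have lMP x : List.In (inr x) l -> List.In x lM.
  by move=> xl; exact: In_pmap xl _.
have [phi' E] := lP (fun v => List.In v l) (fun v vl => vl).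
pose ps := fun j : 'I_(size lM) => projT1 (tnth (in_tuple lM) j).
have /choice[f fE] (x : {v | List.In v l}) : exists v : 'I_n + 'I_(size lM),
    match v, sval x with
    | inl u, inl u' => u = u'
    | inr j, inr y => tnth (in_tuple lM) j = y
    | _, _ => False
    end.
  case: x => -[u|y] /= yl; first by exists (inl u).
  by have [j jy] := In_tnth (lMP _ yl); exists (inr j).
have e x : csum sg ps (f x) = sub_sort (dsort sg) (fun v => List.In v l) x.
  move: (fE x); rewrite /sub_sort; case: (f x) => [u|j]; case: (sval x) => [u'|y] //=.
    by move->.
  by rewrite /ps => ->.
exists (@PFormula _ _ _ (sfull M) _ sg _ ps (frename phi' e)
  (fun j => projT2 (tnth (in_tuple lM) j)) (fun=> I)) => P g a.
rewrite E /peval /= eval_rename; congr eval.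
apply: functional_extensionality_dep => x.
rewrite /sub_args /arename; move: (e x) (fE x); rewrite /sub_sort.
case: (f x) => [u|j]; case: (sval x) => [u'|y] //= + uu'.
  by case: _ / uu' => e'; rewrite (Prop_irrelevance e' erefl).
by case: _ / uu' => e'; rewrite (Prop_irrelevance e' erefl).
Qed.

End FiniteSupport.

Section Automorphisms.
Context {R : realType} {L : signature R} (N : structure L).

Lemma amap_comp (M P Q : structure L) (g : forall s, P s -> Q s)
  (f : forall s, M s -> P s) (V : Type) (sg : V -> lsort L) (a : args M sg) :
  amap g (amap f a) = amap (fun s => g s \o f s) a.
Proof. by []. Qed.

Definition aut_id : automorphism N :=
  @Automorphism R L N (fun s => id) (fun s => @Bijective _ _ id id
    (fun=> erefl) (fun=> erefl)) (fun _ _ _ _ _ => erefl) (fun _ _ _ _ => erefl).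

Lemma aut_comp_fint (g h : automorphism N) n (ar : 'I_n -> lsort L) s
  (f : fsym ar s) (v : args N ar) :
  (g s \o h s) (fint f v) = fint f (amap (fun s => g s \o h s) v).
Proof. by rewrite /= !aut_fint. Qed.

Lemma aut_comp_pint (g h : automorphism N) n (ar : 'I_n -> lsort L)
  (P : psym ar) (v : args N ar) :
  pint P (amap (fun s => g s \o h s) v) = pint P v.
Proof. by rewrite -amap_comp !aut_pint. Qed.

Definition aut_comp (g h : automorphism N) : automorphism N :=
  @Automorphism R L N (fun s => g s \o h s)
    (fun s => bij_comp (aut_bij g s) (aut_bij h s))
    (@aut_comp_fint g h) (@aut_comp_pint g h).

Lemma aut_inverse (g : automorphism N) : exists h : automorphism N,
  (forall s, cancel (g s) (h s)) /\ (forall s, cancel (h s) (g s)).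
Proof.
have H s : {h : N s -> N s | cancel (g s) h /\ cancel h (g s)}.
  by apply: cid; have [h gh hg] := aut_bij g s; exists h.
pose h s := sval (H s).
have gh s : cancel (g s) (h s) := (svalP (H s)).1.
have hg s : cancel (h s) (g s) := (svalP (H s)).2.
have amK (V : Type) (sg : V -> lsort L) (v : args N sg) :
    amap g (amap h v) = v.
  by apply: functional_extensionality_dep => x; exact: hg.
have hb s : bijective (h s) by exists (g s).
have hf n (ar : 'I_n -> lsort L) s (f : fsym ar s) (v : args N ar) :
    h s (fint f v) = fint f (amap h v).
  by apply: (can_inj (gh s)); rewrite hg aut_fint amK.
have hp n (ar : 'I_n -> lsort L) (P : psym ar) (v : args N ar) :
    pint P (amap h v) = pint P v.
  by rewrite -(aut_pint g) amK.
by exists (Automorphism hb hf hp); split=> s; [exact: gh|exact: hg].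
Qed.

End Automorphisms.

Section Monsters.
Context {R : realType} {L : signature R} (M N : structure L) (K : Type).
Context (i : elem_emb M N) (Kinf : [set: nat] #<= [set: K]).
Context (smallM : small K {s : lsort L & M s}).

(** Homogeneity is applied to the tuple [a] together with an enumeration of the
    whole of [M]. *)
Lemma homogeneous_over n (sg : 'I_n -> lsort L) (a a' : args N sg) :
  strongly_homogeneous K N ->
  (forall chi : pformula (sfull M) sg, peval i a chi = peval i a' chi) ->
  exists2 g : automorphism N, forall s (x : M s), g s (i s x) = i s x &
    amap g a = a'.
Proof.
move=> homN aa'.
have [|chi|g gE] := homN _ _ (dargs i a) (dargs i a').
- exact: small_ord_sum.
- by have [chi' E] := dformula_pformula chi; rewrite !E.
exists g => [s x|]; first exact: (gE (inr (existT _ s x))).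
by apply: functional_extensionality_dep => v; exact: (gE (inl v)).
Qed.

Definition npoint (s : lsort L) (x : N s) : {s & N s} :=
  existT (fun s => N s : Type) s x.

Definition add_params (l : seq {s & N s}) : sset N := fun s x =>
  (exists y : {s & M s}, npoint x = npoint (i _ (projT2 y))) \/
  List.In (npoint x) l.

Definition widen_params (A : sset N) n (sg : 'I_n -> lsort L)
  (chi : pformula A sg) : pformula (sfull N) sg :=
  @PFormula _ _ _ (sfull N) _ sg _ _ (pbody chi) (@params _ _ _ _ _ _ chi) (fun=> I).

(** The set of parameters stays small when finitely many elements are added. *)
Lemma saturated_over n (sg : 'I_n -> lsort L) (q : ctype sg (sfull N)) l :
  saturated K N -> exists a : args N sg, forall chi : pformula (add_params l) sg,
    peval (emb_id N) a chi = q (widen_params chi).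
Proof.
move=> satN.
pose Q (x : {s & N s}) := exists y : {s & M s},
  x = npoint (i _ (projT2 y)).
have sQ : small K {x | Q x}.
  pose f (x : {x | Q x}) : {s & M s} := sval (cid (svalP x)).
  apply: (small_inj (f := f)) smallM => -[x hx] [y hy]; rewrite /f /=.
  case: cid => u xu; case: cid => v yv /= uv.
  by apply: eq_exist; rewrite xu yv uv.
have sD : small K {x : {s & N s} | add_params l (projT2 x)}.
  pose f (x : {x : {s & N s} | add_params l (projT2 x)}) :
      {x | Q x \/ List.In x l} :=
    let: exist x Dx := x in
    exist _ x (match x return add_params l (projT2 x) -> Q x \/ List.In x l with
      existT s y => id end Dx).
  apply: (small_inj (f := f)); last exact: small_add_list.
  by move=> [x xD] [y yD] [xy]; exact: eq_exist.
have [a aE] := satN _ sD _ sg (tres (add_params l) q).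
by exists a => chi; have := congr1 (fun t : ctype sg _ => t chi) aE.
Qed.

End Monsters.

(** * Continuous functions of the local type *)

Section TypeTopology.
Context {R : realType} {L : signature R} {n : nat} {sg : 'I_n -> lsort L}.
Context {M : structure L} {A : sset M}.

Lemma ctype_cvg (S : Type) (F : set_system S) (FF : Filter F)
  (u : S -> ctype sg A) (t : ctype sg A) :
  (forall psi, u x psi @[x --> F] --> t psi) -> u x @[x --> F] --> t.
Proof.
move=> ut; apply/cvg_sup => psi W [Z [[V oV VZ] Zt] ZW]; subst Z.
apply: filterS ZW _; apply: (ut psi); exact: open_nbhs_nbhs.
Qed.

Lemma ctype_val_continuous (psi : pformula A sg) :
  continuous (fun t : ctype sg A => t psi : R).
Proof.
move=> t; have /cvg_sup/(_ psi) tt : nbhs t --> t by apply: cvg_id.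
exact: (cvg_comp _ _ tt (@initial_continuous _ _ (fun p : ctype sg A => p psi : R) t)).
Qed.

End TypeTopology.

Section Evaluation.
Context {R : realType} {L : signature R} {n m : nat}.
Context {sg : 'I_n -> lsort L} {ta : 'I_m -> lsort L}.
Variable phi : formula (csum sg ta).

Definition evf (N : structure L) (a : args N sg) (b : args N ta) : R :=
  eval phi (apair a b).

Lemma evf01 (N : structure L) (a : args N sg) (b : args N ta) :
  0 <= evf a b <= 1.
Proof. exact: eval01. Qed.

Lemma evf_stable (T : theory L) (N : structure L) :
  stable T phi -> models N T -> stable_fun (@evf N).
Proof.
by move=> st NT e e0 [a [b ab]]; apply: (st e e0); exists N, a, b.
Qed.

Lemma amap_apair (M N : structure L) (f : forall s, M s -> N s)
  (V W : Type) (s1 : V -> lsort L) (s2 : W -> lsort L) (a : args M s1)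
  (b : args M s2) : amap f (apair a b) = apair (amap f a) (amap f b).
Proof. by apply: functional_extensionality_dep => -[]. Qed.

Lemma evf_emb (M N : structure L) (f : elem_emb M N) a b :
  evf (amap f a) (amap f b) = evf a b.
Proof. by rewrite /evf -amap_apair embP. Qed.

Lemma models_emb (T : theory L) (M N : structure L) (f : elem_emb M N) :
  models M T -> models N T.
Proof.
move=> MT chi /MT <-; rewrite -(embP f); congr eval.
by apply: functional_extensionality_dep => -[].
Qed.

Lemma Sphi_eq (M : structure L) (p q : Sphi phi M) :
  (forall b, phi_val p b = phi_val q b) -> p = q.
Proof.
move=> pq; rewrite -(reprK p) -(reprK q).
by apply/eqmodP/asboolP.
Qed.

Lemma phi_val_pull (M N : structure L) (f : elem_emb M N) (r : Sphi phi N) b :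
  phi_val (Sphi_pull f r) b = phi_val r (amap f b).
Proof. by rewrite /Sphi_pull phi_val_pi. Qed.

(** A local type over [N] is realised in an elementary extension, hence finitely
    approximated by tuples of [N]. *)
Lemma Sphi_approx (N : structure L) (r : Sphi phi N) (l : seq (args N ta))
  (d : R) : 0 < d -> exists a : args N sg,
  forall b, List.In b l -> `|evf a b - phi_val r b| < d.
Proof.
move=> d0; have [P [f [a' rE]]] := tvalP (repr r).
have [a aP] := peval_approx f a' [seq pinst phi b | b <- l] d0.
by exists a => b bl; rewrite /phi_val rE; exact: (aP (pinst phi b) (List.in_map _ _ _ bl)).
Qed.

(** The value at [r] of the continuous extension of [F]: two tuples that are
    both within [e / 2] of [r] on [beta] are within [e] of each other. *)
Definition ext_value (N : structure L) (F : args N sg -> R) (r : Sphi phi N)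
    (v : R) : Prop :=
  0 <= v <= 1 /\ forall e beta, 0 < e -> uc_on (@evf N) beta e F ->
    forall a, (forall b, List.In b beta -> `|evf a b - phi_val r b| <= e / 2) ->
      `|F a - v| <= 3 * e.

(** The limit of [F] along tuples that tend to [r]. *)
Lemma ext_value_exists (N : structure L) (F : args N sg -> R) (r : Sphi phi N) :
  (forall a, 0 <= F a <= 1) -> exists v, ext_value F r v.
Proof.
move=> F01.
have [W WW Wr] := ultrafilter_of_approx (@Sphi_approx N r).
have PW : ProperFilter W := @ultra_proper _ _ WW.
have [|v Fv v01] := @ultra_bounded_cvg R _ W WW F.
  by apply: filterS filterT => a _; exact: F01.
exists v; split => // e beta e0 uc a aP.
have WF : W [set a' | `|F a - F a'| <= 3 * e].
  have : W [set a' | forall b, List.In b beta ->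
      `|evf a' b - phi_val r b| < e / 2].
    apply: filter_list => b _; have /cvg_distP := Wr b; apply; lra.
  apply: filterS => a' a'P; apply: uc => b bl.
  have := aP b bl; have := a'P b bl => /=; rewrite distrC => ? ?.
  by have := ler_distD (phi_val r b) (evf a b) (evf a' b); lra.
rewrite distrC ler_distl; apply/andP; split.
  apply: (cvg_ge_lim Fv); apply: filterS WF => a' /=.
  by rewrite ler_distl; lra.
apply: (cvg_le_lim Fv); apply: filterS WF => a' /=.
by rewrite ler_distl; lra.
Qed.

Definition fixes (N : structure L) (A : sset N) (g : automorphism N) : Prop :=
  forall s (a : N s), A s a -> g s a = a.

Lemma small_eq (x y : R) (c : R) :
  (forall e, 0 < e -> `|x - y| <= c * e) -> x = y.
Proof.
move=> xy; apply/eqP; rewrite -subr_eq0 -normr_eq0 eq_le normr_ge0 andbT.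
apply/ler_addgt0Pl => e e0; rewrite addr0.
pose c' := Num.max c 1; have c'1 : 1 <= c' by rewrite le_max lexx orbT.
have c'0 : 0 < c' by apply: lt_le_trans c'1.
have cc' : c <= c' by rewrite le_max lexx.
have ec : 0 < e / c' by rewrite divr_gt0.
apply: le_trans (xy _ ec) _.
by rewrite mulrCA -[X in _ <= X]mulr1 ler_pM2l// ler_pdivrMr// mul1r.
Qed.

(** To compare the values at two local types, compare both with [F a] for a
    tuple [a] of [N] that approximates them on the finitely many instances
    controlling [F]. *)
Lemma ext_predicate (N : structure L) (A : sset N) (F : args N sg -> R)
  (Fhat : Sphi phi N -> R) :
  (forall e, 0 < e -> exists beta, uc_on (@evf N) beta e F) ->
  (forall g, fixes A g -> forall a, F (amap g a) = F a) ->
  (forall r, ext_value F r (Fhat r)) -> phi_predicate A Fhat.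
Proof.
move=> Fuc Finv Fext; split; first split.
- apply/quotient_continuous => t.
  apply: (snd (@cvg_distP R _ _ (nbhs_filter t) _ _)) => e e0.
  have e7 : 0 < e / 7 by lra.
  have [beta uc] := Fuc _ e7.
  have : nbhs t [set t' : ctype sg (sfull N) | forall b, List.In b beta ->
      `|t' (pinst phi b) - t (pinst phi b)| < e / 7 / 4].
    apply: filter_list => b _.
    have ct := @ctype_val_continuous R L n sg N (sfull N) (pinst phi b) t.
    by apply: (fst (@cvg_distP R _ _ (nbhs_filter t) _ _) ct); lra.
  apply: filterS => t' t't /=.
  have [|a aP] := Sphi_approx (\pi_(Sphi phi N) t) beta (d := e / 7 / 4).
    lra.
  have [_ Et] := Fext (\pi_(Sphi phi N) t).
  have [_ Et'] := Fext (\pi_(Sphi phi N) t').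
  have {}Et : `|F a - Fhat (\pi_(Sphi phi N) t)| <= 3 * (e / 7).
    by apply: Et uc _ _ => // b /aP; lra.
  have {}Et' : `|F a - Fhat (\pi_(Sphi phi N) t')| <= 3 * (e / 7).
    apply: Et' uc _ _ => // b bb; have := aP _ bb; have := t't _ bb.
    rewrite !phi_val_pi distrC => ? ?.
    have := ler_distD (t (pinst phi b)) (evf a b) (t' (pinst phi b)); lra.
  have := ler_distD (F a) (Fhat (\pi_(Sphi phi N) t')) (Fhat (\pi_(Sphi phi N) t)).
  by rewrite (distrC (Fhat _) (F a)); lra.
- by move=> r; have [] := Fext r.
move=> g gA r; apply: (@small_eq _ _ 6) => e e0.
have [beta uc] := Fuc _ e0.
have [_ /(_ _ _ e0 uc) Ep] := Fext (Sphi_pull (emb_aut g) r).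
have [h [gh hg]] := aut_inverse g.
have amK (V : Type) (s : V -> lsort L) (v : args N s) : amap g (amap h v) = v.
  by apply: functional_extensionality_dep => x; exact: hg.
have evg a b : evf (amap g a) (amap g b) = evf a b := evf_emb (emb_aut g) a b.
have ucg : uc_on (@evf N) [seq amap g b | b <- beta] e F.
  have Fh x : F x = F (amap h x).
    by have := Finv g gA (amap h x); rewrite amK.
  move=> a a' aa'; rewrite (Fh a) (Fh a'); apply: uc => b bb.
  have := aa' (amap g b) (List.in_map _ _ _ bb).
  by rewrite -(evg (amap h a)) -(evg (amap h a')) !amK.
have [_ /(_ _ _ e0 ucg) Er] := Fext r.
have e2 : 0 < e / 2 by lra.
have [a aP] := Sphi_approx (Sphi_pull (emb_aut g) r) beta e2.
have := Ep a (fun b bb => ltW (aP b bb)).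
have := Er (amap g a); rewrite Finv// => + ?.
have near b : List.In b [seq amap g b | b <- beta] ->
    `|evf (amap g a) b - phi_val r b| <= e / 2.
  move=> /List.in_map_iff[b' [<- bb']]; rewrite evg.
  by rewrite -[phi_val r _](phi_val_pull (emb_aut g)); exact/ltW/aP.
move=> /(_ near) ?.
have := ler_distD (F a) (Fhat (Sphi_pull (emb_aut g) r)) (Fhat r).
by rewrite (distrC (Fhat _) (F a)); lra.
Qed.

End Evaluation.

(** * The value at a definable type *)

Section Values.
Context {R : realType} {L : signature R} (T : theory L) {n m : nat}.
Context {sg : 'I_n -> lsort L} {ta : 'I_m -> lsort L}.
Context (phi : formula (csum sg ta)) (stphi : stable T phi).
Context (M N : structure L) (MT : models M T) (i : elem_emb M N) (A : sset M).
Context (b0 : args M ta).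

Definition orbit_instances : set (args N sg -> R) :=
  [set h | exists2 g : automorphism N, fixes (simage i A) g &
    h = fun a => evf phi a (amap g (amap i b0))].

Lemma orbit_instances01 (h : args N sg -> R) :
  orbit_instances h -> forall a, 0 <= h a <= 1.
Proof. by move=> [g _ ->] a; exact: evf01. Qed.

Definition flip_var (x : 'I_n + 'I_m) : 'I_m + 'I_n :=
  match x with inl v => inr v | inr w => inl w end.

Lemma flip_sort x : csum ta sg (flip_var x) = csum sg ta x.
Proof. by case: x. Defined.

Definition flip_inst (a : args M sg) : pformula (sfull M) ta :=
  @PFormula _ _ M (sfull M) _ ta _ _ (frename phi flip_sort) a (fun=> I).

Lemma peval_flip (P : structure L) (f : elem_emb M P) (b : args P ta) a :
  peval f b (flip_inst a) = evf phi (amap f a) b.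
Proof.
rewrite /peval /= eval_rename; congr eval.
by apply: functional_extensionality_dep => -[].
Qed.

Definition full_params (chi : pformula A ta) : pformula (sfull M) ta :=
  @PFormula _ _ M (sfull M) _ ta _ _ (pbody chi) (@params _ _ _ _ _ _ chi) (fun=> I).

(** Parameters in [A] do not see the difference between [b0] and its
    conjugates over [A]. *)
Lemma peval_orbit (g : automorphism N) (chi : pformula A ta) :
  fixes (simage i A) g ->
  peval i (amap g (amap i b0)) (full_params chi) = peval (emb_id M) b0 chi.
Proof.
move=> gA; rewrite /peval /=.
rewrite (_ : amap i (@params _ _ _ _ _ _ chi) =
  amap g (amap i (@params _ _ _ _ _ _ chi))); last first.
  apply: functional_extensionality_dep => x; rewrite /amap gA//.
  by exists (@params _ _ _ _ _ _ chi x) => //; exact: params_in.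
by rewrite -!amap_apair (aut_embP g) (embP i).
Qed.

Variables (p : Sphi phi M) (U : set_system (args M sg)) (UU : UltraFilter U).
Hypothesis defp : definable_over A p.
Hypothesis Up : forall b : args M ta, evf phi a b @[a --> U] --> phi_val p b.

(** The two orders of limits of [phi x y], with [x] tending to [p] and [y] to a
    point of the closure of the orbit of [b0]: the definition of [p] is over
    [A], hence constant on the orbit. *)
Lemma coheir_value (h : args N sg -> R) :
  pclosure orbit_instances h -> h (amap i a) @[a --> U] --> phi_val p b0.
Proof.
move=> hcl; have PU : ProperFilter U := @ultra_proper _ _ UU.
pose cond (x : args M sg + pformula A ta) : pformula (sfull M) ta :=
  match x with inl a => flip_inst a | inr chi => full_params chi end.
pose lim_val (x : args M sg + pformula A ta) : R :=
  match x with
  | inl a => h (amap i a)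
  | inr chi => peval (emb_id M) b0 chi
  end.
have [|V VV Vlim] := @ultrafilter_of_approx R (args M ta) _
    (fun x b => peval (emb_id M) b (cond x)) lim_val.
  move=> l d d0; have d2 : 0 < d / 2 by lra.
  pose left (x : args M sg + pformula A ta) := if x is inl a then Some a else None.
  have [k [g gA ->] kh] := hcl [seq amap i a | a <- pmap left l] (d / 2) d2.
  have [b bP] := peval_approx i (amap g (amap i b0)) [seq cond x | x <- l] d2.
  exists b => -[a|chi] xl; have := bP _ (List.in_map _ _ _ xl) => /=.
    have flipE : peval (emb_id M) b (flip_inst a) = evf phi a b.
      by rewrite peval_flip.
    rewrite !flipE peval_flip => ?.
    have := kh _ (List.in_map _ _ _ (In_pmap xl (erefl : left (inl a) = Some a))).
    have := ler_distD (evf phi (amap i a) (amap g (amap i b0)))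
      (evf phi a b) (h (amap i a)); lra.
  by rewrite peval_orbit// => H; apply: lt_trans H _; lra.
have PV : ProperFilter V := @ultra_proper _ _ VV.
have [t ht _] : exists2 t : R, h (amap i a) @[a --> U] --> t & 0 <= t <= 1.
  apply: ultra_bounded_cvg; apply: filterS filterT => a _ /=.
  exact: (pclosure01 orbit_instances01 hcl).
have -> // : phi_val p b0 = t.
apply: (@double_limit _ _ _ (@evf _ _ _ _ _ _ phi M) U V PU PV (phi_val p)
  (fun a => h (amap i a))) => //.
- exact: evf_stable stphi MT.
- move=> a.
  have E : (fun b => peval (emb_id M) b (cond (inl a))) = evf phi a.
    by apply/funext => b; exact: (peval_flip (emb_id M)).
  by have := Vlim (inl a); rewrite E.
have [psi [_ pE] [g [g_cont _] psiE]] := defp.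
have gE b : phi_val p b = g (tres A (tp (sfull M) b)) by rewrite pE psiE.
rewrite (funext gE : phi_val p = _).
have tp_cvg : tres A (tp (sfull M) b) @[b --> V] --> tres A (tp (sfull M) b0).
  by apply: (ctype_cvg (@filter_filter _ _ PV)) => chi; exact: (Vlim (inr chi)).
exact: (cvg_comp _ _ tp_cvg (g_cont _)).
Qed.

End Values.

Section Envelopes.
Context {R : realType} {L : signature R} (T : theory L) {n m : nat}.
Context {sg : 'I_n -> lsort L} {ta : 'I_m -> lsort L}.
Context (phi : formula (csum sg ta)) (stphi : stable T phi).
Context (M N : structure L) (MT : models M T) (i : elem_emb M N) (A : sset M).
Context (b0 : args M ta) (K : Type) (Kinf : [set: nat] #<= [set: K]).
Context (satN : saturated K N) (homN : strongly_homogeneous K N).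
Context (smallM : small K {s : lsort L & M s}).
Variable Y : set (args N sg -> R).
Hypotheses (Yn : Y !=set0) (Y01 : forall h, Y h -> forall a, 0 <= h a <= 1).
Hypothesis Ycl : Y `<=` pclosure (orbit_instances phi i A b0).
Hypothesis Yequi : forall e, 0 < e ->
  exists beta, forall h, Y h -> uc_on (@evf _ _ _ _ _ _ phi N) beta e h.
Hypothesis Yinv : forall g : automorphism N, fixes (simage i A) g ->
  forall a, envelope Y (amap g a) = envelope Y a.

(** [a1] realises [r] and [a2] a coheir of its type over [M]; they are conjugate
    over [M], and at [a2] the value is computed by [coheir_value]. *)
Lemma ext_value_at (p : Sphi phi M) (r : Sphi phi N) (v : R) :
  definable_over A p -> Sphi_pull i r = p -> ext_value (envelope Y) r v ->
  v = phi_val p b0.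
Proof.
move=> defp rp [_ vP]; apply: (@small_eq _ _ _ 6) => e e0.
have [beta equi] := Yequi e0.
have uc := envelope_uc Yn Y01 equi.
(* The coordinates of the parameters that control the supremum. *)
pose l := flatten [seq [seq npoint (b w) | w <- enum 'I_m] | b <- beta].
pose D := add_params i l.
have betaD b : List.In b beta -> forall w, D _ (b w).
  move=> bb w; right; apply: (In_flatten bb).
  exact: (List.in_map _ _ _ (In_enum w)).
have MD (k : nat) (ps : 'I_k -> lsort L) (c : args M ps) w : D _ (amap i c w).
  by left; exists (existT _ (ps w) (c w)).
pose instD b (bD : forall w, D _ (b w)) : pformula D sg :=
  @PFormula _ _ N D _ sg _ _ phi b bD.
have [a1 a1P] := saturated_over i Kinf smallM (repr r) l satN.
have a1b b : (forall w, D _ (b w)) -> evf phi a1 b = phi_val r b.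
  by move=> bD; exact: (a1P (instD b bD)).
have a1M b : evf phi a1 (amap i b) = phi_val p b.
  by rewrite a1b ?rp -?phi_val_pull ?rp//; exact: MD.
have near1 : `|envelope Y a1 - v| <= 3 * e.
  by apply: vP uc _ _ => // b /betaD bD; rewrite a1b// subrr normr0; lra.
have [W WW Wchi] := ultrafilter_of_approx (peval_approx i a1).
have PW : ProperFilter W := @ultra_proper _ _ WW.
have [q qP] := ultralimit_type WW (fun a : args M sg => amap i a).
have [a2 a2P] := saturated_over i Kinf smallM q l satN.
have a12 (chi : pformula (sfull M) sg) : peval i a1 chi = peval i a2 chi.
  pose chiD : pformula D sg := @PFormula _ _ N D _ sg _ _ (pbody chi)
    (amap i (@params _ _ _ _ _ _ chi)) (MD _ _ _).
  rewrite -[RHS]/(peval (emb_id N) a2 chiD) a2P.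
  apply: (cvg_unique _ (Wchi chi)); first exact: Rhausdorff.
  have E : (fun a => peval (emb_id N) (amap i a) (widen_params chiD)) =
      (fun a => peval (emb_id M) a chi).
    by apply/funext => a; rewrite /peval /= -[RHS](embP i) amap_apair.
  by have := qP (widen_params chiD); rewrite E.
have [g gM ga1] := homogeneous_over Kinf smallM homN a12.
have gA : fixes (simage i A) g by move=> s _ [x _ <-]; exact: gM.
have near2 : `|envelope Y a2 - phi_val p b0| <= 3 * e.
  apply: envelope_near => // h Yh.
  have hs : h (amap i a) @[a --> W] --> phi_val p b0.
    apply: (coheir_value stphi MT WW defp) (Ycl Yh) => b.
    by rewrite -a1M; exact: (Wchi (pinst phi b)).
  have close : W [set a | `|h (amap i a) - h a2| <= 3 * e].
    have : W [set a | forall b, List.In b beta ->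
        `|evf phi (amap i a) b - evf phi a2 b| < e].
      apply: filter_list => b /betaD bD.
      have -> : evf phi a2 b = q (pinst phi b) by exact: (a2P (instD b bD)).
      by have /cvg_distP := qP (pinst phi b); exact.
    by apply: filterS => a aP; apply: equi => // b /aP/ltW.
  rewrite distrC ler_distl; apply/andP; split.
    apply: (cvg_ge_lim hs); apply: filterS close => a /=.
    by rewrite ler_distl; lra.
  apply: (cvg_le_lim hs); apply: filterS close => a /=.
  by rewrite ler_distl; lra.
rewrite -ga1 Yinv// in near2.
have := ler_distD (envelope Y a1) v (phi_val p b0).
by rewrite (distrC v (envelope Y a1)); lra.
Qed.

End Envelopes.

(** Without variables [x], the value of [phi] is determined by elementarity. *)
Lemma phi_val_void (R : realType) (L : signature R) n m (sg : 'I_n -> lsort L)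
  (ta : 'I_m -> lsort L) (phi : formula (csum sg ta)) (M : structure L)
  (p : Sphi phi M) (b : args M ta) : n = 0%N ->
  phi_val p b = eval phi (apair (apoint M sg) b).
Proof.
move=> n0; have [P [f [a pE]]] := tvalP (repr p).
rewrite /phi_val pE /peval /= -(embP f) amap_apair; congr eval; congr apair.
apply: functional_extensionality_dep => v; exfalso.
by move: (leq_ltn_trans (leq0n v) (ltn_ord v)); rewrite [X in (_ < X)%N -> _]n0.
Qed.

Section Existence.
Context {R : realType} {L : signature R} (T : theory L) {n m : nat}.
Context {sg : 'I_n -> lsort L} {ta : 'I_m -> lsort L}.
Context (phi : formula (csum sg ta)) (stphi : stable T phi).
Context (M N : structure L) (NT : models N T) (i : elem_emb M N) (A : sset M).
Context (b0 : args M ta).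

Definition fixing_maps : set (args N sg -> args N sg) :=
  [set t | exists2 g : automorphism N, fixes (simage i A) g & t = @amap R L N N g _ sg].

(** A minimal set in the closure of the orbit of the instance [phi x b0], with
    all the properties that [ext_predicate] and [ext_value_at] ask of it. *)
Lemma orbit_minimal : exists Y : set (args N sg -> R),
  [/\ Y !=set0, forall h, Y h -> forall a, 0 <= h a <= 1,
      Y `<=` pclosure (orbit_instances phi i A b0),
      forall e, 0 < e ->
        exists beta, forall h, Y h -> uc_on (@evf _ _ _ _ _ _ phi N) beta e h &
      forall g : automorphism N, fixes (simage i A) g ->
        forall a, envelope Y (amap g a) = envelope Y a].
Proof.
have id_fixes : fixes (simage i A) (aut_id N) by [].
have inv_fixes (g : automorphism N) : fixes (simage i A) g ->
    exists h, [/\ fixes (simage i A) h, forall s, cancel (g s) (h s) &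
      forall s, cancel (h s) (g s)].
  move=> gA; have [h [gh hg]] := aut_inverse g; exists h; split => // s a Aa.
  by rewrite -[in LHS](gA s a Aa) gh.
have Gid : fixing_maps id by exists (aut_id N).
have Gcomp t t' : fixing_maps t -> fixing_maps t' -> fixing_maps (t \o t').
  move=> [g gA ->] [g' g'A ->]; exists (aut_comp g g') => // s a Aa /=.
  by rewrite g'A// gA.
have Ginv t : fixing_maps t -> exists2 t', fixing_maps t' & cancel t' t.
  move=> [g /inv_fixes[h [hA gh hg]] ->].
  exists (@amap R L N N h _ sg); first by exists h.
  by move=> a; apply: functional_extensionality_dep => x; exact: hg.
have Gphi t : fixing_maps t -> forall b, exists b', forall a,
    evf phi (t a) b = evf phi a b'.
  move=> [g /inv_fixes[h [hA gh hg]] ->] b; exists (amap h b) => a.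
  rewrite -[LHS](evf_emb phi (emb_aut h)) /=; congr evf.
  by apply: functional_extensionality_dep => x; exact: gh.
pose X := pclosure (orbit_instances phi i A b0).
have X01 := pclosure01 (@orbit_instances01 _ _ _ _ _ _ phi M N i A b0).
have sX : subflow fixing_maps X.
  split => //; last first.
  - move=> t h [g gA ->] hX l d d0.
    have [k [g' g'A ->] kh] := hX [seq amap g a | a <- l] d d0.
    have [g1 [g1A gg1 g1g]] := inv_fixes g gA.
    exists (fun a => evf phi a (amap (aut_comp g1 g') (amap i b0))).
      by exists (aut_comp g1 g') => // s a Aa /=; rewrite g'A// g1A.
    move=> a al /=; have := kh _ (List.in_map _ _ _ al).
    congr (`|_ - _| < _); rewrite -[LHS](evf_emb phi (emb_aut g1)) /=.
    congr evf; apply: functional_extensionality_dep => x; exact: gg1.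
  - exact: pclosure_idem.
  exists (fun a => evf phi a (amap (aut_id N) (amap i b0))) => l d d0.
  exists (fun a => evf phi a (amap (aut_id N) (amap i b0))).
    by exists (aut_id N).
  by move=> a _; rewrite subrr normr0.
have [Y [YX sY Ymin]] := minimal_subflow sX.
have [Yn _ Y01 _] := sY; exists Y; split => //.
- move=> e e0; apply: (@minimal_equicontinuous R _ _ (@evf _ _ _ _ _ _ phi N)
    fixing_maps Gid Gcomp Gphi Ginv Y e) => //.
  + exact: evf_stable stphi NT.
  + by move=> a b; exact: evf01.
  move=> h /YX hX l d d0; have [k [g _ ->] kh] := hX l d d0.
  by exists (fun a => evf phi a (amap g (amap i b0))) => //; exists (amap g (amap i b0)).
move=> g gA a.
have Gg : fixing_maps (@amap R L N N g _ sg) by exists g.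
exact: (congr1 (fun F => F a) (envelope_inv Ginv sY Gg)).
Qed.

End Existence.

Theorem proposition7p17 (R : realType) (L : signature R) (T : theory L)
  (canL : has_canonical_sorts T)
  (n m : nat) (sg : 'I_n -> lsort L) (ta : 'I_m -> lsort L)
  (phi : formula (csum sg ta)) (stphi : stable T phi)
  (M : structure L) (MT : models M T)
  (K : Type) (N : structure L) (monN : monster K N)
  (i : elem_emb M N) (smallM : small K {s : lsort L & M s})
  (A : sset M) (aclA : algebraically_closed (simage i A))
  (p p' : Sphi phi M)
  (defp : definable_over A p) (defp' : definable_over A p')
  (q : Sphi_over phi (simage i A))
  (pA : restricts_to p q) (p'A : restricts_to p' q) :
  p = p'.
Proof.
apply: Sphi_eq => b0.
have [n0|n_gt0] := posnP n; first by rewrite !phi_val_void.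
have [smallL satN homN] := monN.
have Kinf := small_formulae_infinite (sg (Ordinal n_gt0)) smallL.
have [Y [Yn Y01 Ycl Yequi Yinv]] :=
  @orbit_minimal R L T n m sg ta phi stphi M N (models_emb i MT) i A b0.
have env01 a : 0 <= envelope Y a <= 1.
  have [h Yh] := Yn; have [_ /ub_le_sup le_sup] := envelope_has_sup a Yn Y01.
  apply/andP; split.
    apply: le_trans (le_sup _ (ex_intro2 _ _ h Yh erefl)).
    by have /andP[] := Y01 h Yh a.
  apply: ge_sup; first by exists (h a), h.
  by move=> _ [k Yk <-]; have /andP[] := Y01 k Yk a.
have /choice[Fhat FhatP] r := ext_value_exists (r : Sphi phi N) env01.
have Fpred : phi_predicate (simage i A) Fhat.
  apply: ext_predicate FhatP => // e /Yequi[beta equi].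
  by exists beta; exact: envelope_uc.
have [r rp rq] := pA; have [r' r'p' r'q] := p'A.
have <- := ext_value_at stphi MT Kinf satN homN smallM Yn Y01 Ycl Yequi Yinv
  defp rp (FhatP r).
have <- := ext_value_at stphi MT Kinf satN homN smallM Yn Y01 Ycl Yequi Yinv
  defp' r'p' (FhatP r').
have /eqmodP/asboolP : \pi_({eq_quot (over_equiv_rel phi (simage i A))}) r =
    \pi_({eq_quot (over_equiv_rel phi (simage i A))}) r'.
  by rewrite -r'q in rq.
exact.
Qed.
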